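(* Let $k\geq 3$ and let $G$ be a $k$-connected but not $(k+1)$-connected graph with $n$ vertices and $m$ edges. Then $mc(G)=m-n+k$ if and only if $G\in\mathcal{B}^1_{n,k}\cup\mathcal{B}^2_{n,k}\cup\mathcal{B}^3_{n,k}$.
   Context: All graphs are simple, finite and undirected. A complete graph $K_{p}$ is regarded as $(p-1)$-connected but not $p$-connected. An edge-coloring of a connected graph $G$ (an arbitrary assignment of colors to edges) is a monochromatic connection coloring (MC-coloring) if any two vertices of $G$ are connected by a path all of whose edges have the same color. The monochromatic connection number $mc(G)$ is the maximum number of colors used in an MC-coloring of $G$. $G\vee H$ denotes the join of vertex-disjoint graphs $G$ and $H$ (add all edges between $V(G)$ and $V(H)$). $K_p^-$ denotes the graph obtained from $K_p$ by removing one edge (so $K_2^-=2K_1$, two isolated vertices). Pairwise disjoint vertex sets $U_1,\dots,U_s$ of $G$ ''form a complete $s$-partite graph'' if every vertex of $U_i$ is adjacent in $G$ to every vertex of $U_j$ for all $i\neq j$ (edges inside the $U_i$ are allowed). A graph is $s$-perfectly-connected if its vertex set can be partitioned into $s+1$ parts $\{v\},V_1,\dots,V_s$ such that each $V_i$ induces a connected subgraph, $V_1,\dots,V_s$ form a complete $s$-partite graph, and $v$ has precisely one neighbor in each $V_i$. $\mathcal{A}_{n,k}$ is the set of graphs $K_{k-1}\vee H$, where $H$ is a connected graph with $|V(H)|=n-k+1$ and $H$ has a cut-vertex. The following are sets of graphs on $n$ vertices. $\mathcal{B}^1_{n,k}$ is the set of graphs $G$ such that: $G$ is $k$-connected; $V(G)$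 can be partitioned into $k$ nonempty sets $\{u\},U_1,\dots,U_{k-1}$ such that each $G[U_i\cup\{u\}]$ is connected and $U_1,\dots,U_{k-1}$ form a complete $(k-1)$-partite graph, and there is an integer $t\in\{1,\dots,k-1\}$ such that $u$ has precisely two neighbors in $U_t$ and precisely one neighbor in $U_i$ for each $i\neq t$; and $G$ is neither a $k$-perfectly-connected graph nor a graph of $\mathcal{A}_{n,k}$. $\mathcal{B}^2_{n,k}$ is the set of graphs $G$ such that: $G$ is $k$-connected; $V(G)$ can be partitioned into two parts $U,V$ such that $G[U]=K_{k-2}$, $G[V]$ is a $2$-connected but not $3$-connected graph and $G=G[U]\vee G[V]$; and $G$ is neither a $k$-perfectly-connected graph nor a graph of $\mathcal{A}_{n,k}$. $\mathcal{B}^3_{n,k}$ is the set of graphs $G$ such that: $G$ is $k$-connected; $V(G)$ can be partitioned into two parts $U,V$ such that $G[U]=K_{k-1}^-$, $G[V]$ is a connected graph with a cut-vertex and $G=G[U]\vee G[V]$; and $G$ is neither a $k$-perfectly-connected graph nor a graph of $\mathcal{A}_{n,k}$. *)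

(* Defs.v *)
From mathcomp Require Import all_boot.

Set Implicit Arguments.
Unset Strict Implicit.
Unset Printing Implicit Defensive.

Record sgraph := SGraph {
  vertex :> finType;
  adj : rel vertex;
  adj_sym : symmetric adj;
  adj_irrefl : irreflexive adj }.

Notation "x -- y" := (adj x y) (at level 30, no associativity).

Definition iso (F G : sgraph) : Prop :=
  exists2 f : F -> G, bijective f & forall x y, f x -- f y = x -- y.

Section Constructions.

Variable G : sgraph.

Section Induced.
Variable U : {set G}.
Definition induced_adj : rel {x : G | x \in U} := fun x y => val x -- val y.
Fact induced_sym : symmetric induced_adj.
Proof. by move=> x y; apply: adj_sym. Qed.
Fact induced_irrefl : irreflexive induced_adj.
Proof. by move=> x; apply: adj_irrefl. Qed.
Definition induced : sgraph := SGraph induced_sym induced_irrefl.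
End Induced.

Section DeleteEdge.
Variables a b : G.
Definition del_edge_adj : rel G :=
  fun x y => x -- y && ([set x; y] != [set a; b]).
Fact del_edge_sym : symmetric del_edge_adj.
Proof. by move=> x y; rewrite /del_edge_adj adj_sym setUC. Qed.
Fact del_edge_irrefl : irreflexive del_edge_adj.
Proof. by move=> x; rewrite /del_edge_adj adj_irrefl. Qed.
Definition del_edge : sgraph := SGraph del_edge_sym del_edge_irrefl.
End DeleteEdge.

Definition edges : {set {set G}} :=
  [set [set p.1; p.2] | p : G * G in [pred p | p.1 -- p.2]].

End Constructions.

Section Join.
Variables G H : sgraph.
Definition join_adj : rel (G + H)%type := fun x y =>
  match x, y with
  | inl x', inl y' => x' -- y'
  | inr x', inr y' => x' -- y'
  | _, _ => true
  end.
Fact join_sym : symmetric join_adj.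
Proof. by case=> x [] y //=; apply: adj_sym. Qed.
Fact join_irrefl : irreflexive join_adj.
Proof. by case=> x /=; apply: adj_irrefl. Qed.
Definition join : sgraph := SGraph join_sym join_irrefl.
End Join.

Section Complete.
Variable p : nat.
Definition complete_adj : rel 'I_p := fun x y => x != y.
Fact complete_sym : symmetric complete_adj.
Proof. by move=> x y; rewrite /complete_adj eq_sym. Qed.
Fact complete_irrefl : irreflexive complete_adj.
Proof. by move=> x; rewrite /complete_adj eqxx. Qed.
Definition complete : sgraph := SGraph complete_sym complete_irrefl.
End Complete.

Definition is_complete (p : nat) (F : sgraph) : Prop := iso F (complete p).

Definition is_complete_minus (p : nat) (F : sgraph) : Prop :=
  exists2 ab : complete p * complete p,
    ab.1 -- ab.2 & iso F (del_edge ab.1 ab.2).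

Definition connected (G : sgraph) : Prop :=
  0 < #|G| /\ forall x y : G, connect (@adj G) x y.

(* The condition k < #|G| makes K_p exactly (p-1)-connected. *)
Definition k_connected (k : nat) (G : sgraph) : Prop :=
  k < #|G| /\ forall S : {set G}, #|S| < k -> connected (induced (~: S)).

(* A cut-vertex separates two other vertices of the same component; in
   particular K_1 and K_2 have none. *)
Definition cut_vertex (G : sgraph) (v : G) : Prop :=
  exists x y : induced [set~ v],
    connect (@adj G) (val x) (val y) /\
    ~ connect (@adj (induced [set~ v])) x y.

Definition has_cut_vertex (G : sgraph) : Prop := exists v : G, cut_vertex v.

Section Colorings.
Variable G : sgraph.

Definition mono_adj (C : finType) (c : {ffun {set G} -> C}) (a : C) : rel G :=
  fun x y => x -- y && (c [set x; y] == a).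

(* Edge-colorings are functions on all vertex subsets, of which only the
   values on [edges G] matter. *)
Definition mc_coloring (C : finType) (c : {ffun {set G} -> C}) : bool :=
  [forall x, forall y, exists a, connect (mono_adj c a) x y].

Definition ncolors (C : finType) (c : {ffun {set G} -> C}) : nat :=
  #|[set c e | e in edges G]|.

(* Taking {set G}, which contains the edges, as the palette loses no
   generality: see [ncolors_le_mc]. *)
Definition mc : nat :=
  \max_(c : {ffun {set G} -> {set G}} | mc_coloring c) ncolors c.

Lemma edgesP (x y : G) : x -- y -> [set x; y] \in edges G.
Proof. by move=> xy; apply/imsetP; exists (x, y). Qed.

Lemma ncolors_le_mc (C : finType) (c : {ffun {set G} -> C}) :
  mc_coloring c -> ncolors c <= mc.
Proof.
move=> mcc.
pose r (a : C) := odflt set0 [pick e in edges G | c e == a].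
pose c' := [ffun e => r (c e)].
have rK e : e \in edges G -> c (r (c e)) = c e.
  move=> eE; rewrite /r; case: pickP => [e' /andP[_ /eqP] // | /(_ e)].
  by rewrite eE eqxx.
have mcc' : mc_coloring c'.
  apply/forallP=> x; apply/forallP=> y.
  have /existsP[a xy] := forallP (forallP mcc x) y.
  apply/existsP; exists (r a); apply: connect_sub xy => u v /andP[uv /eqP <-].
  by apply: connect1; rewrite /mono_adj uv /c' ffunE eqxx.
apply: leq_trans (leq_bigmax_cond (F := @ncolors _) _ mcc').
rewrite /ncolors -(card_in_imset (f := r) (D := [set c e | e in edges G])).
  rewrite -imset_comp; apply/subset_leq_card/subsetP=> _ /imsetP[e eE ->].
  by apply/imsetP; exists e; rewrite ?ffunE.
by move=> _ _ /imsetP[e eE ->] /imsetP[f fE ->] /(congr1 c); rewrite !rK.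
Qed.

End Colorings.

Section Classes.
Variable G : sgraph.

Definition nbrs_in (u : G) (U : {set G}) : {set G} := [set y in U | u -- y].

Definition pointed_partition (s : nat) (u : G) (U : 'I_s -> {set G}) : Prop :=
  [/\ forall i, U i != set0,
      forall i, u \notin U i,
      forall i j, i != j -> [disjoint U i & U j]
    & u |: \bigcup_i U i = [set: G]].

Definition complete_multipartite (s : nat) (U : 'I_s -> {set G}) : Prop :=
  forall i j, i != j -> forall x y, x \in U i -> y \in U j -> x -- y.

Definition perfectly_connected (s : nat) : Prop :=
  exists (v : G) (V : 'I_s -> {set G}),
    [/\ pointed_partition v V,
        forall i, connected (induced (V i)),
        complete_multipartite V
      & forall i, #|nbrs_in v (V i)| = 1].

(* V(G) is partitioned into U and W, and G is the join of G[U] and G[W]. *)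
Definition join_partition (U W : {set G}) : Prop :=
  [/\ U != set0, W != set0, [disjoint U & W], U :|: W = [set: G]
    & forall x y, x \in U -> y \in W -> x -- y].

Lemma join_partition_iso (U W : {set G}) :
  join_partition U W -> iso (join (induced U) (induced W)) G.
Proof.
move=> [_ _ dUW UW adjUW].
pose f (z : join (induced U) (induced W)) : G :=
  match z with inl x => val x | inr y => val y end.
have nUW x : x \in U -> x \in W -> False.
  by move=> xU xW; have := disjointFr dUW xU; rewrite xW.
exists f.
  apply: inj_card_bij.
    move=> [] [x xP] [] [y yP] //= xy.
    - by congr inl; apply: val_inj.
    - by case: (nUW x) => //; rewrite xy.
    - by case: (nUW y) => //; rewrite -xy.
    - by congr inr; apply: val_inj.
  by rewrite card_sum !card_sig -cardsT -UW cardsU disjoint_setI0 // cards0 subn0.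
move=> [] [x xP] [] [y yP] //=; first exact: adjUW.
by rewrite adj_sym adjUW.
Qed.

Definition class_A (n k : nat) : Prop :=
  exists H : sgraph,
    [/\ connected H, #|H| = n - k + 1, has_cut_vertex H
      & iso G (join (complete (k - 1)) H)].

Definition class_B1 (n k : nat) : Prop :=
  [/\ #|G| = n,
      k_connected k G,
      exists (u : G) (U : 'I_(k - 1) -> {set G}),
        [/\ pointed_partition u U,
            forall i, connected (induced (u |: U i)),
            complete_multipartite U
          & exists t, #|nbrs_in u (U t)| = 2 /\
                      forall i, i != t -> #|nbrs_in u (U i)| = 1],
      ~ perfectly_connected k
    & ~ class_A n k].

Definition class_B2 (n k : nat) : Prop :=
  [/\ #|G| = n,
      k_connected k G,
      exists U W : {set G},
        [/\ join_partition U W,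
            is_complete (k - 2) (induced U),
            k_connected 2 (induced W)
          & ~ k_connected 3 (induced W)],
      ~ perfectly_connected k
    & ~ class_A n k].

Definition class_B3 (n k : nat) : Prop :=
  [/\ #|G| = n,
      k_connected k G,
      exists U W : {set G},
        [/\ join_partition U W,
            is_complete_minus (k - 1) (induced U),
            connected (induced W)
          & has_cut_vertex (induced W)],
      ~ perfectly_connected k
    & ~ class_A n k].

End Classes.

(* Main.v *)
Require Import Defs.
From mathcomp Require Import all_boot zify.

(* Give each colour of an MC-coloring the vertex sets of its components: this
   covers the nonadjacent pairs by connected vertex sets, and conversely any
   such cover [F], once its members pairwise share at most one vertex, yields a
   coloring through spanning trees.  Hence mc(G) = m - w(G), where w(G) is the
   least weight \sum_(S in F) (#|S| - 2) of a cover.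

   Let C be a cut with k vertices separating A from B.  A member of F meeting
   both A and B meets C, and the traces on A :|: B of these members cover all
   pairs of A x B, so \sum (|S :&: A| + |S :&: B| - 1) >= |A| + |B| - 1 = n-k-1.
   Thus w(G) >= n-k-1, and w(G) = n-k leaves one unit of slack.  If |A| = 1 the
   traces partition B and G is read off as a (nearly) k-perfectly-connected
   graph.  If |A|, |B| >= 2, an exchange argument on a cover with fewest members
   shows that the slack is not in the last sum; a single member then contains
   A :|: B, and the slack decides between the second and the third class. *)

Set Implicit Arguments.
Unset Strict Implicit.
Unset Printing Implicit Defensive.

(** * Linked vertex sets *)

(** Minimality of a cover is lexicographic, weight before number of members. Merging two members
    that share two vertices, or dropping one with at most two vertices, costs no weight; the
    tie-break thus makes members large and pairwise almost disjoint.

    A crossing member has a vertex in the cut, so its weight is its trace term plus the number of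
    its cut vertices less one. A member that does not cross keeps its whole weight, at least one, as
    excess. One unit of excess is therefore one exceptional member: a crossing one with two cut
    vertices, or a triple that does not cross. The obstacle is a sum of trace terms one above its
    minimum: with two vertices on each side, some vertex of B would lie in exactly two members,
    which linearity and the exchange exclude.

    For the converse, each of the three classes supplies a cover of weight at most n-k. The value
    n-k-1 is attained exactly by the k-perfectly-connected graphs and the graphs in A_{n,k}, so the
    exclusions in the definitions of the classes turn this bound into an equality. *)

Section Linked.
Variable G : sgraph.
Implicit Types (x y z : G) (X Y P : {set G}).

Definition adjin X : rel G := fun x y => [&& x \in X, y \in X & x -- y].

(** The relation lives on [G] itself, so that unions and one-vertex extensions need no passage
    between subtypes. The empty set is linked; nonemptiness is stated apart in
    [connected_induced]. *)
Definition linked X := [forall x in X, forall y in X, connect (adjin X) x y].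

Lemma linkedP X :
  reflect {in X &, forall x y, connect (adjin X) x y} (linked X).
Proof.
apply: (iffP 'forall_in_forall_inP) => [h x y xX yX | h x xX y yX]; exact: h.
Qed.

Lemma connect_adjin_sym X : connect_sym (adjin X).
Proof.
by apply: sym_connect_sym => x y; rewrite /adjin adj_sym andbCA.
Qed.

Lemma connect_adjinS X Y x y :
  X \subset Y -> connect (adjin X) x y -> connect (adjin Y) x y.
Proof.
move=> /subsetP sXY; apply: connect_sub => u v /and3P[uX vX uv].
by apply: connect1; rewrite /adjin !sXY.
Qed.

Lemma linked_from X x :
  (forall y, y \in X -> connect (adjin X) x y) -> linked X.
Proof.
move=> h; apply/linkedP => y z yX zX.
by apply: connect_trans (h z zX); rewrite connect_adjin_sym h.
Qed.

Lemma linked_closed X P x :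
  linked X -> x \in X -> x \in P ->
  {in X &, forall y z, y \in P -> y -- z -> z \in P} -> X \subset P.
Proof.
move=> /linkedP lX xX xP cl; apply/subsetP => y /(lX x _ xX) /connectP[p + ->].
elim: p x xX xP => [|z p IH] x xX xP //= /andP[/and3P[_ zX xz]].
by apply: IH => //; apply: cl xz.
Qed.

(** With [linked_closed] this describes linkedness by closed sets instead of paths, a form that
    transfers directly along injective maps in [linked_imset]. *)
Lemma closed_linked X :
  (forall P x, x \in X -> x \in P ->
   {in X &, forall y z, y \in P -> y -- z -> z \in P} -> X \subset P) ->
  linked X.
Proof.
move=> h; apply/linkedP => x y xX yX.
have xP : x \in [set z | connect (adjin X) x z] by rewrite inE.
suff /subsetP/(_ y yX) : X \subset [set z | connect (adjin X) x z] by rewrite inE.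
apply: (h _ x xX xP) => u v uX vX.
rewrite !inE => xu uv; apply: connect_trans xu (connect1 _).
by rewrite /adjin uX vX.
Qed.

Lemma linked_split X P x y :
  linked X -> x \in X -> x \in P -> y \in X -> y \notin P ->
  exists u v, [/\ u \in X, u \in P, v \in X, v \notin P & u -- v].
Proof.
move=> lX xX xP yX yP.
case: (boolP [exists u, exists v,
  [&& u \in X, u \in P, v \in X, v \notin P & u -- v]]).
  by case/existsP => u /existsP[v /and5P[]]; exists u, v.
move=> /existsPn h; case/negP: yP.
have /subsetP : X \subset P; last exact.
apply: (linked_closed lX xX xP) => u v uX vX uP uv.
have /existsPn/(_ v) := h u; rewrite uX uP vX uv andbT /=.
by move/negPn.
Qed.

Lemma linkedU X Y z :
  linked X -> linked Y -> z \in X -> z \in Y -> linked (X :|: Y).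
Proof.
move=> /linkedP lX /linkedP lY zX zY; apply: (@linked_from _ z) => y.
case/setUP => [yX | yY].
  by apply: connect_adjinS (lX _ _ zX yX); apply: subsetUl.
by apply: connect_adjinS (lY _ _ zY yY); apply: subsetUr.
Qed.

Lemma linked1 x : linked [set x].
Proof. by apply/linkedP => y z /set1P-> /set1P->. Qed.

Lemma linked2 x y : x -- y -> linked [set x; y].
Proof.
move=> xy; apply: (@linked_from _ x) => z /set2P[]-> //.
by apply: connect1; rewrite /adjin !inE !eqxx orbT.
Qed.

Lemma linkedU1 X x z : linked X -> z \in X -> x -- z -> linked (x |: X).
Proof.
move=> lX zX xz.
have -> : x |: X = [set x; z] :|: X.
  by apply/setP => w; rewrite !inE; case: (w =P z) => [->|]; rewrite ?zX ?orbT ?orbF.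
by apply: (@linkedU _ _ z) => //; [exact: linked2 | rewrite !inE eqxx orbT].
Qed.

(** Here [x] is a leaf or isolated in [X]: a path through [x] would enter and leave by the same
    neighbour [s]. *)
Lemma linkedD1 X x s :
  linked X -> x \in X -> (forall y, y \in X -> x -- y -> y = s) ->
  linked (X :\ x).
Proof.
move=> lX xX xs; apply: (@linked_from _ s) => y /setD1P[yx yX].
have : X \subset x |: [set z | connect (adjin (X :\ x)) s z].
  apply: (linked_closed lX xX); first exact: setU11.
  move=> u v uX vX /setU1P[->|]; first by move/(xs v vX)->; rewrite !inE connect0 orbT.
  rewrite !inE => su uv; case: (eqVneq v x) => //= vx.
  case: (eqVneq u x) => [ux|ux]; first by rewrite (xs v) // -ux.
  by apply: connect_trans su (connect1 _); rewrite /adjin !inE ux vx uX vX.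
by move/subsetP/(_ y yX); rewrite !inE (negPf yx).
Qed.

Lemma linked3 X : linked X -> #|X| = 3 ->
  exists x y z, [/\ X = [set x; y; z], x != y, x -- z & y -- z].
Proof.
move=> lX X3.
have /card_gt0P[a aX] : 0 < #|X| by rewrite X3.
have [b bX ba] : exists2 b, b \in X & b \notin [set a].
  by apply/subsetPn; apply/negP => /subset_leq_card; rewrite X3 cards1.
have [a' [b' [_ /set1P-> bX' ba' ab]]] := linked_split lX aX (set11 a) bX ba.
have aab : a \in [set a; b'] by rewrite !inE eqxx.
have [c cX cab] : exists2 c, c \in X & c \notin [set a; b'].
  apply/subsetPn; apply/negP => /subset_leq_card.
  by rewrite X3 cards2; case: (_ != _).
have [u [d [_ uab dX dab ud]]] := linked_split lX aX aab cX cab.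
have Xe : X = [set a; b'; d].
  apply/esym/eqP; rewrite eqEcard X3; apply/andP; split.
    by apply/subsetP => y /setUP[/set2P[]|/set1P]->.
  rewrite setUC cardsU1 dab cards2; move: ba'; rewrite inE eq_sym.
  by move=> ->.
move: dab; rewrite !inE negb_or => /andP[da db].
case/set2P: uab => ue; rewrite ue in ud.
  exists b', d, a; split; [|by rewrite eq_sym|by rewrite adj_sym|by rewrite adj_sym].
  by rewrite Xe; apply/setP => y; rewrite !inE; do !case: (_ == _).
exists a, d, b'; split; [|by rewrite eq_sym|by []|by rewrite adj_sym].
by rewrite Xe; apply/setP => y; rewrite !inE; do !case: (_ == _).
Qed.

Lemma linked3_nadj X x y z t : linked X -> #|X| = 3 ->
  x \in X -> y \in X -> x != y -> ~~ x -- y ->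
  z \in X -> t \in X -> z != t -> ~~ z -- t -> [set x; y] = [set z; t].
Proof.
move=> lX X3; have [a [b [d [Xe ab ad bd]]]] := linked3 lX X3.
have cl u v : u \in X -> v \in X -> u != v -> ~~ u -- v ->
    [set u; v] = [set a; b].
  rewrite Xe => /setUP[uab|/set1P->] /setUP[vab|/set1P->] uv nuv.
  - by apply/eqP; rewrite eqEcard subUset !sub1set uab vab !cards2 uv ab.
  - by case/set2P: uab nuv => ->; rewrite ?ad ?bd.
  - by case/set2P: vab nuv => ->; rewrite adj_sym ?ad ?bd.
  - by rewrite eqxx in uv.
by move=> xX yX xy nxy zX tX zt nzt; rewrite !cl.
Qed.

End Linked.

Lemma linked_imset (H G : sgraph) (f : H -> G) (Y : {set H}) :
  injective f -> (forall x y, f x -- f y = x -- y) ->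
  linked (f @: Y) = linked Y.
Proof.
move=> fI fE; apply/idP/idP => lY; apply: closed_linked => P x.
  move=> xY xP cl.
  have : f @: Y \subset f @: P.
    apply: (linked_closed lY (imset_f f xY) (imset_f f xP)).
    move=> _ _ /imsetP[u uY ->] /imsetP[v vY ->].
    by rewrite !mem_imset // fE; apply: cl.
  move=> /subsetP sYP; apply/subsetP => y /(imset_f f) /sYP.
  by rewrite mem_imset.
case/imsetP => x' xY -> xP cl; apply/subsetP => _ /imsetP[y yY ->].
have /subsetP/(_ y yY) : Y \subset f @^-1: P; last by rewrite inE.
apply: (linked_closed lY xY); first by rewrite inE.
move=> u v uY vY; rewrite !inE => uP uv.
by apply: (cl (f u) (f v)) => //; rewrite ?imset_f ?fE.
Qed.

Lemma connectedE (G : sgraph) :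
  connected G <-> 0 < #|G| /\ linked [set: G].
Proof.
have h x y : connect (@adj G) x y = connect (adjin [set: G]) x y.
  by apply: eq_connect => u v; rewrite /adjin !inE.
split=> [[G0 c]|[G0 /linkedP c]]; split => //.
  by apply/linkedP => x y _ _; rewrite -h.
by move=> x y; rewrite h c.
Qed.

Lemma imset_val_setT (G : sgraph) (X : {set G}) :
  val @: [set: induced X] = X.
Proof.
apply/setP => x; apply/imsetP/idP => [[y _ ->]|xX]; first exact: (valP y).
by exists (Sub x xX).
Qed.

Lemma card_induced (G : sgraph) (X : {set G}) : #|induced X| = #|X|.
Proof. by rewrite card_sig. Qed.

Lemma linked_val (G : sgraph) (X : {set G}) (Y : {set induced X}) :
  linked (val @: Y) = linked Y.
Proof. exact: (@linked_imset (induced X) G val Y val_inj). Qed.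

Lemma connected_induced (G : sgraph) (X : {set G}) :
  connected (induced X) <-> X != set0 /\ linked X.
Proof.
rewrite connectedE card_induced card_gt0 -linked_val.
by rewrite imset_val_setT.
Qed.

(** * Covers and the monochromatic connection number *)

Section Covers.
Variable G : sgraph.
Implicit Types (x y z : G) (S X Y P : {set G}) (E F : {set {set G}}).

Definition covering F : bool :=
  [forall S in F, linked S] &&
  [forall x, forall y, (x != y) && ~~ x -- y ==>
    [exists S in F, (x \in S) && (y \in S)]].

Lemma coveringP F :
  reflect ((forall S, S \in F -> linked S) /\
           (forall x y, x != y -> ~~ x -- y ->
              exists S, [/\ S \in F, x \in S & y \in S]))
          (covering F).
Proof.
apply: (iffP andP) => [[/forall_inP lF /forallP h]|[lF h]]; split=> //.
- move=> x y xy nxy; have /forallP/(_ y) := h x; rewrite xy nxy /=.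
  by case/exists_inP => S SF /andP[xS yS]; exists S.
- exact/forall_inP.
- apply/forallP => x; apply/forallP => y; apply/implyP => /andP[xy nxy].
  have [S [SF xS yS]] := h x y xy nxy.
  by apply/exists_inP; exists S => //; rewrite xS.
Qed.

(* A spanning tree of [S] with a single colour saves [#|S| - 2] colours
   fewer than a rainbow one; truncation makes the sets of size at most 1 free. *)
Definition weight F := \sum_(S in F) (#|S| - 2).

End Covers.

(* Cardinals and weights have to be abstracted first: [lia] sees convertible but
   syntactically different predicates as distinct atoms. *)
Ltac card_lia :=
  repeat match goal with
  | H : is_true (_ <= _) |- _ => revert H
  | H : @eq nat _ _ |- _ => revert H
  end;
  repeat (let c := fresh "c" in move: #|_| => c);
  repeat (let w := fresh "w" in move: (weight _) => w);
  clear; lia.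

Section Weights.
Variable G : sgraph.
Implicit Types (x y z : G) (S X Y P : {set G}) (E F : {set {set G}}).

Lemma card_edge (e : {set G}) : e \in edges G -> #|e| = 2.
Proof.
case/imsetP => -[x y]; rewrite inE /= => xy ->; rewrite cards2.
by case: eqP xy => // ->; rewrite adj_irrefl.
Qed.

Lemma edges_inv (e : {set G}) :
  e \in edges G -> exists x y, e = [set x; y] /\ x -- y.
Proof. by case/imsetP => -[x y]; rewrite inE /= => xy ->; exists x, y. Qed.

(** The usual count of components: the classes start as singletons, and each edge merges at most two
    of them. A class is linked because the merging edges are edges of [G]. *)
Lemma component_labels E : E \subset edges G ->
  exists f : G -> G,
    [/\ forall x, linked [set y | f y == f x],
        forall x y, [set x; y] \in E -> f x = f y
      & #|G| <= #|E| + #|f @: setT|].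
Proof.
have [n] := ubnP #|E|; elim: n E => // n IH E; rewrite ltnS => En sE.
have [->|/set0Pn[e eE]] := eqVneq E set0.
  exists id; split.
  - by move=> x; rewrite (_ : [set y | _] = [set x]) ?linked1 //; apply/setP => y; rewrite !inE.
  - by move=> x y; rewrite inE.
  - by rewrite cards0 imset_id cardsT.
have cE : #|E| = #|E :\ e|.+1 by rewrite (cardsD1 e) eE.
have [|//|f [lf fE fn]] := IH (E :\ e); first by rewrite -ltnS -cE.
  by apply: subset_trans sE; apply: subsetDl.
have [x [y [ee xy]]] := edges_inv (subsetP sE e eE).
pose h z := if f z == f x then f y else f z.
have hyx : h x = h y by rewrite /h eqxx; case: eqP.
exists h; split.
- move=> z.
  have hcls u : (h u == f y) = (f u == f x) || (f u == f y).
    by rewrite /h; case: (f u == f x) => /=; rewrite ?eqxx.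
  case: (boolP ((f z == f x) || (f z == f y))) => fz.
    have hz : h z = f y by apply/eqP; rewrite hcls.
    rewrite hz.
    have -> : [set u | h u == f y] =
        ([set u | f u == f x] :|: [set x; y]) :|: [set u | f u == f y].
      apply/setP => u; rewrite !inE hcls; case: (u =P x) => [->|_]; first by rewrite !eqxx.
      by case: (u =P y) => [->|_]; rewrite ?eqxx ?orbT ?orbF.
    apply: (@linkedU _ _ _ y) => //; last by rewrite inE.
      by apply: (@linkedU _ _ _ x); rewrite ?inE ?eqxx //; apply: linked2.
    by rewrite !inE eqxx !orbT.
  move: fz; rewrite negb_or => /andP[fzx fzy].
  have -> : [set u | h u == h z] = [set u | f u == f z]; last exact: lf.
  apply/setP => u; rewrite !inE /h (negPf fzx); case: (f u =P f x) => [->|//].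
  by rewrite eq_sym (negPf fzy) eq_sym (negPf fzx).
- move=> u v uvE; case: (eqVneq [set u; v] e) => [uve|uve]; last first.
    by rewrite /h (fE u v) // !inE uve.
  have [] : u \in [set x; y] /\ v \in [set x; y].
    by rewrite -ee -uve !inE !eqxx orbT.
  by case/set2P => ->; case/set2P => ->.
- apply: leq_trans fn _; rewrite cE addSnnS leq_add2l.
  have sf : f @: setT \subset f x |: h @: setT.
    apply/subsetP => _ /imsetP[u _ ->]; case: (eqVneq (f u) (f x)) => [->|fu].
      exact: setU11.
    by apply/setU1P; right; apply/imsetP; exists u; rewrite // /h (negPf fu).
  by apply: leq_trans (subset_leq_card sf) _; rewrite cardsU1; case: (_ \notin _).
Qed.

(** The members are the label classes, singletons included. Summing [#|S| - 1] over them gives at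
    most [#|E|], and subtracting 2 instead of 1 gains at least one more on a class that contains an
    edge. This strict inequality pays for the colour itself. *)
Lemma color_class_covering E : E \subset edges G -> E != set0 ->
  exists F, [/\ forall S, S \in F -> linked S,
    forall x y, connect [rel u v | [set u; v] \in E] x y ->
      exists S, [/\ S \in F, x \in S & y \in S]
    & weight F < #|E|].
Proof.
move=> sE /set0Pn[e eE]; have [f [lf fE fn]] := component_labels sE.
pose fib l := [set y | f y == l].
exists (fib @: (f @: setT)); split.
- by move=> _ /imsetP[_ /imsetP[x _ ->] ->]; apply: lf.
- move=> x y /connectP[p]; elim: p x => [|z p IH] x /=.
    by move=> _ ->; exists (fib (f x)); rewrite !inE eqxx; split=> //; rewrite !imset_f.
  by case/andP => /fE xz /IH h /h [S [SF zS yS]]; exists S; split => //;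
     move: SF zS => /imsetP[l _ ->]; rewrite !inE xz.
have [x [y [ee xy]]] := edges_inv (subsetP sE e eE).
have w1 : weight (fib @: (f @: setT)) <= \sum_(l in f @: setT) (#|fib l| - 2).
  rewrite /weight big_imset //= => l l' /imsetP[u _ ->] _ /setP/(_ u).
  by rewrite !inE eqxx => /esym/eqP.
apply: leq_ltn_trans w1 _.
have fxI : f x \in f @: setT by rewrite imset_f.
have s1 : \sum_(l in f @: setT) #|fib l| = #|G|.
  rewrite -cardsT -[RHS]sum1_card [RHS](partition_big_imset f) /=.
  apply: eq_bigr => l _; rewrite -sum1_card; apply: eq_bigl => u.
  by rewrite !inE.
have pos l : l \in f @: setT -> 0 < #|fib l|.
  by case/imsetP => u _ ->; apply/card_gt0P; exists u; rewrite inE.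
have s2 : \sum_(l in f @: setT) (#|fib l| - 1) + #|f @: setT| = #|G|.
  rewrite -sum1_card -big_split /= -s1; apply: eq_bigr => l /pos; lia.
have le1 : \sum_(l in f @: setT) (#|fib l| - 1) <= #|E| by lia.
apply: leq_trans le1.
have fx2 : 1 < #|fib (f x)|.
  rewrite -(card_edge (subsetP sE e eE)) ee; apply: subset_leq_card.
  by apply/subsetP => z /set2P[]->; rewrite inE // (fE x y) // -ee.
rewrite (bigD1 (f x)) //= [ltnRHS](bigD1 (f x)) //= -addSn leq_add //; first lia.
by apply: leq_sum => l _; lia.
Qed.

Lemma weightD1 F S : S \in F -> weight F = #|S| - 2 + weight (F :\ S).
Proof. by move=> SF; rewrite /weight (big_setD1 S). Qed.

Lemma weightU F F' : weight (F :|: F') <= weight F + weight F'.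
Proof.
rewrite {1}/weight (big_setID F) /= setUK setDUl setDv set0U leq_add2l.
by rewrite [leqRHS](big_setID F) /= leq_addl.
Qed.

Lemma weight1 S : weight [set S] = #|S| - 2.
Proof. by rewrite /weight big_set1. Qed.

Lemma weight_bigcup (I : finType) (A : {set I}) (FF : I -> {set {set G}}) :
  weight (\bigcup_(i in A) FF i) <= \sum_(i in A) weight (FF i).
Proof.
apply: (big_rec2 (fun F n => weight F <= n)); first by rewrite /weight big_set0.
move=> i n F _ h; apply: leq_trans (weightU _ _) _.
by rewrite leq_add2l.
Qed.

Lemma mc_coloring_covering (C : finType) (c : {ffun {set G} -> C}) :
  mc_coloring c ->
  exists F, covering F /\ ncolors c + weight F <= #|edges G|.
Proof.
move=> mcc; pose A := [set c e | e in edges G].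
pose E a := [set e in edges G | c e == a].
have sE a : E a \subset edges G by apply/subsetP => e; rewrite inE => /andP[].
have E0 a : a \in A -> E a != set0.
  by case/imsetP => e eE ->; apply/set0Pn; exists e; rewrite inE eE eqxx.
have /fin_all_exists[FF FFP] : forall a, exists F, a \in A ->
  [/\ forall S, S \in F -> linked S,
    forall x y, connect [rel u v | [set u; v] \in E a] x y ->
      exists S, [/\ S \in F, x \in S & y \in S]
    & weight F < #|E a|].
  move=> a; case: (boolP (a \in A)) => [aA|_]; last by exists set0.
  by have [F FP] := color_class_covering (sE a) (E0 a aA); exists F.
exists (\bigcup_(a in A) FF a); split.
  apply/coveringP; split=> [S /bigcupP[a /FFP[l _ _] /l] //|x y xy nxy].
  have /existsP[a cxy] := forallP (forallP mcc x) y.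
  (* The path joins distinct vertices, so its first edge shows that the colour [a] occurs. *)
  have aA : a \in A.
    case/connectP: cxy xy => -[|z p] /=; first by move=> _ ->; rewrite eqxx.
    by move=> /andP[/andP[xz /eqP<-] _] _ _; rewrite imset_f // edgesP.
  have [_ cov _] := FFP a aA.
  have [|S [SF xS yS]] := cov x y.
    apply: connect_sub cxy => u v /andP[uv cuv]; apply: connect1 => /=.
    by rewrite inE edgesP.
  by exists S; split=> //; apply/bigcupP; exists a.
have sm : \sum_(a in A) #|E a| = #|edges G|.
  rewrite -[RHS]sum1_card [RHS](partition_big_imset c) /=; apply: eq_bigr => a _.
  by rewrite -sum1_card; apply: eq_bigl => e; rewrite !inE.
rewrite -sm /ncolors -/A -sum1_card.
apply: leq_trans (_ : \sum_(a in A) 1 + \sum_(a in A) weight (FF a) <= _).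
  by rewrite leq_add2l weight_bigcup.
by rewrite -big_split /=; apply: leq_sum => a /FFP[_ _]; rewrite add1n.
Qed.

(** A tree grown from a root [r] by one edge at a time: after [n] steps it has [n.+1] vertices and
    at most [n] edges. *)
Lemma spanning_edges X : linked X -> X != set0 ->
  exists E, [/\ E \subset edges G, forall e, e \in E -> e \subset X, #|E| < #|X|
    & {in X &, forall x y, connect [rel u v | [set u; v] \in E] x y}].
Proof.
move=> lX /set0Pn[r rX].
suff h n : n < #|X| -> exists Y E, [/\ Y \subset X, r \in Y, #|Y| = n.+1 &
   [/\ E \subset edges G, forall e, e \in E -> e \subset X, #|E| <= n &
     forall y, y \in Y -> connect [rel u v | [set u; v] \in E] r y]].
  have X0 : 0 < #|X| by apply/card_gt0P; exists r.
  have [|Y [E [sYX rY cY [sE EX cE lE]]]] := h #|X|.-1; first by rewrite prednK.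
  rewrite prednK // in cY.
  have YX : Y = X by apply/eqP; rewrite eqEcard sYX cY leqnn.
  exists E; split=> //; first by rewrite -(prednK X0).
  rewrite -YX => x y /lE rx /lE; apply: connect_trans.
  by rewrite (sym_connect_sym (e := [rel u v | [set u; v] \in E])) // => u v /=; rewrite setUC.
elim: n => [|n IH] nX.
  exists [set r], set0; split; rewrite ?sub1set ?set11 ?cards1 //.
  split; rewrite ?sub0set ?cards0 //; first by move=> e; rewrite inE.
  by move=> y /set1P->.
have [|Y [E [sYX rY cY [sE EX cE lE]]]] := IH; first exact: ltnW.
have [z zX zY] : exists2 z, z \in X & z \notin Y.
  by apply/subsetPn; apply/negP => /subset_leq_card; rewrite cY leqNgt nX.
have [u [v [uX uY vX vY uv]]] := linked_split lX rX rY zX zY.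
exists (v |: Y), ([set u; v] |: E); split.
- by rewrite subUset sub1set vX.
- by rewrite setU1r.
- by rewrite cardsU1 vY cY.
split.
- by rewrite subUset sub1set edgesP.
- by move=> e /setU1P[->|/EX //]; rewrite subUset !sub1set uX.
- by rewrite cardsU1; case: (_ \notin _) => //=; apply: leqW.
have lE' y : y \in Y -> connect [rel u0 v0 | [set u0; v0] \in [set u; v] |: E] r y.
  move=> /lE; apply: connect_sub => a b /= abE; apply: connect1 => /=.
  exact: setU1r.
move=> y /setU1P[->|]; last exact: lE'.
by apply: connect_trans (lE' u uY) (connect1 _) => /=; apply: setU11.
Qed.

(** A linear hypergraph in the usual sense: trees spanning different members share no edge, so they
    can be coloured independently. *)
Definition linear F := {in F &, forall S S', S != S' -> #|S :&: S'| <= 1}.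

(** The palette [{set G}] lets a member be its own colour: the tree of [S] is coloured [S], and an
    edge outside all trees is coloured by itself. The bound [3 <= #|S|] keeps the two kinds of
    colours apart, since an edge has two elements. *)
Lemma covering_mc_coloring F :
  covering F -> linear F -> (forall S, S \in F -> 3 <= #|S|) ->
  exists c : {ffun {set G} -> {set G}},
    mc_coloring c /\ #|edges G| <= ncolors c + weight F.
Proof.
move=> /coveringP[lF cF] linF F3.
have /fin_all_exists[T TP] : forall S : {set G}, exists E : {set {set G}}, S \in F ->
   [/\ E \subset edges G, forall e, e \in E -> e \subset S, #|E| < #|S|
    & {in S &, forall x y, connect [rel u v | [set u; v] \in E] x y}].
  move=> S; case: (boolP (S \in F)) => [SF|_]; last by exists set0.
  have [|E EP] := spanning_edges (lF S SF); last by exists E.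
  by rewrite -card_gt0; apply: leq_trans (F3 S SF).
pose c := [ffun e : {set G} => odflt e [pick S in F | e \in T S]].
have cT S e : S \in F -> e \in T S -> c e = S.
  move=> SF eT; rewrite ffunE; case: pickP => [S' /andP[SF' eT']|/(_ S)]; last by rewrite SF eT.
  apply/eqP; apply: contraTT isT => /= nSS.
  have := linF S' S SF' SF nSS; rewrite leqNgt => /negP; case.
  have [sT sS _ _] := TP S SF; have [_ sS' _ _] := TP S' SF'.
  rewrite -(card_edge (subsetP sT e eT)); apply: subset_leq_card.
  by rewrite subsetI sS' ?sS.
exists c; split.
  apply/forallP => x; apply/forallP => y; apply/existsP.
  have [<-|xy] := eqVneq x y; first by exists set0.
  case: (boolP (x -- y)) => [axy|nxy].
    by exists (c [set x; y]); apply: connect1; rewrite /mono_adj axy eqxx.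
  have [S [SF xS yS]] := cF x y xy nxy; exists S.
  have [sT _ _ cS] := TP S SF.
  apply: connect_sub (cS x y xS yS) => u v /= uvT; apply: connect1.
  rewrite /mono_adj (cT S) // eqxx andbT.
  have [a [b [uvab ab]]] := edges_inv (subsetP sT _ uvT).
  have := card_edge (subsetP sT _ uvT); rewrite cards2 => uvn.
  have : u \in [set a; b] /\ v \in [set a; b] by rewrite -uvab !inE !eqxx orbT.
  case=> /set2P[]ue /set2P[]ve; move: uvn; rewrite ue ve ?eqxx //.
  by rewrite adj_sym.
pose D := \bigcup_(S in F) T S.
have sI : F :|: (edges G :\: D) \subset [set c e | e in edges G].
  apply/subsetP => S /setUP[SF|/setDP[SE SD]].
    have [sT _ _ cS] := TP S SF.
    have /card_gt1P[x [y [xS yS xy]]] : 1 < #|S| by apply: leq_trans (F3 S SF).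
    case/connectP: (cS x y xS yS) xy => -[|z p] /=; first by move=> _ ->; rewrite eqxx.
    case/andP => xzT _ _ _; apply/imsetP; exists [set x; z]; first exact: (subsetP sT).
    by rewrite (cT S).
  apply/imsetP; exists S => //; rewrite ffunE; case: pickP => //= S' /andP[S'F ST].
  by case/negP: SD; apply/bigcupP; exists S'.
have := subset_leq_card sI; rewrite -/(ncolors c) => nc.
have dj : F :&: (edges G :\: D) = set0.
  apply/setP => S; rewrite !inE; apply/negP => /and3P[SF _ SE].
  by have := F3 S SF; rewrite (card_edge SE).
move: nc; rewrite cardsU dj cards0 subn0 => nc.
have cD : #|D| <= \sum_(S in F) #|T S|.
  apply: (big_rec2 (fun (X : {set {set G}}) n => #|X| <= n)); first by rewrite cards0.
  move=> S n X _ h; apply: leq_trans (leq_card_setU _ _) _.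
  by rewrite leq_add2l.
(* A tree has at most [#|S| - 1] edges, one more than the weight of [S]; this unit is returned by
   the colour [S]. *)
have w1 : \sum_(S in F) #|T S| <= weight F + #|F|.
  rewrite /weight -sum1_card -big_split /=; apply: leq_sum => S SF.
  have [_ _ TS _] := TP S SF; have S3 := F3 S SF; rewrite addn1 -ltnS; apply: leq_trans TS _.
  by move: S3; clear; lia.
have := cardsID D (edges G); have := subset_leq_card (subsetIr (edges G) D).
lia.
Qed.

(** * Minimal covers and their exchange properties *)

Definition tight F := covering F /\
  forall F', covering F' ->
    weight F < weight F' \/ weight F = weight F' /\ #|F| <= #|F'|.

(** [N] exceeds the size of every family, so minimising [weight F * N + #|F|] realises the
    lexicographic order. The whole vertex set as only member shows that covers exist. *)
Lemma exists_tight : linked [set: G] -> exists F, tight F.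
Proof.
move=> lG; have cov0 : covering [set [set: G]].
  apply/coveringP; split=> [S /set1P-> //|x y _ _].
  by exists [set: G]; rewrite !inE.
pose N := #|{set G}|.+1.
have [F cF Fm] := arg_minnP (fun F => weight F * N + #|F|) cov0.
exists F; split=> // F' /Fm /= h.
have F'N : #|F'| < N by rewrite ltnS; apply: max_card.
case: (ltngtP (weight F) (weight F')) => [w|w|wE]; [by left| |by right; move: h; rewrite wE leq_add2l].
have := leq_mul w (leqnn N); rewrite mulSn => w2.
have : weight F * N < N + weight F' * N.
  by apply: leq_ltn_trans (leq_addr _ _) (leq_ltn_trans h _); rewrite addnC ltn_add2r.
by rewrite ltnNge w2.
Qed.

Section Tight.
Variable F : {set {set G}}.
Hypothesis tF : tight F.

Lemma tight_linked S : S \in F -> linked S.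
Proof. by case: tF => /coveringP[h _] _; apply: h. Qed.

Lemma tight_cover x y : x != y -> ~~ x -- y ->
  exists S, [/\ S \in F, x \in S & y \in S].
Proof. by case: tF => /coveringP[_ h] _; apply: h. Qed.

Lemma tight_no_smaller F' :
  covering F' -> weight F' <= weight F -> #|F'| < #|F| -> False.
Proof. by case: tF => _ /(_ F') h /h; lia. Qed.

(** A linked set with at most two vertices contains no nonadjacent pair, so dropping it leaves a
    cover. *)
Lemma tight_card S : S \in F -> 3 <= #|S|.
Proof.
move=> SF; rewrite leqNgt; apply/negP => S2.
apply: (@tight_no_smaller (F :\ S)).
- apply/coveringP; split=> [S' /setD1P[_ /tight_linked]//|x y xy nxy].
  have [S' [SF' xS yS]] := tight_cover xy nxy; exists S'; split=> //.
  rewrite !inE SF' andbT; apply/negP => /eqP SS; rewrite SS in xS yS.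
  have SE : S = [set x; y].
    by apply/esym/eqP; rewrite eqEcard subUset !sub1set xS yS cards2 xy -ltnS.
  have ynx : y \notin [set x] by rewrite inE eq_sym.
  have [u [v [uS /set1P ux vS vx uv]]] := linked_split (tight_linked SF) xS (set11 x) yS ynx.
  move: vS vx; rewrite SE !inE => /orP[->//|/eqP vy] _.
  by rewrite ux vy (negPf nxy) in uv.
- by rewrite (weightD1 SF) leq_addl.
- by rewrite [ltnRHS](cardsD1 S) SF.
Qed.

(** Two members with two common vertices can be merged: the union is linked, [#|S :|: S'| - 2] is at
    most the sum of the two weights, and one member is saved. *)
Lemma tight_linear : linear F.
Proof.
move=> S S' SF SF' nSS; rewrite leqNgt; apply/negP => I2.
have SF1 : S' \in F :\ S by rewrite !inE eq_sym nSS.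
apply: (@tight_no_smaller ((S :|: S') |: (F :\ S :\ S'))).
- apply/coveringP; split=> [S1 /setU1P[->|]|x y xy nxy].
  + have /card_gt0P[z /setIP[zS zS']] : 0 < #|S :&: S'| by apply: leq_trans I2.
    by apply: (@linkedU _ _ _ z) => //; apply: tight_linked.
  + by move=> /setD1P[_ /setD1P[_ /tight_linked]].
  have [S1 [SF1' xS yS]] := tight_cover xy nxy.
  case: (boolP ((S1 == S) || (S1 == S'))) => [SS|].
    exists (S :|: S'); rewrite setU11 !inE.
    by case/orP: SS => /eqP<-; rewrite xS yS ?orbT.
  by rewrite negb_or => /andP[h1 h2]; exists S1; rewrite !inE h1 h2 SF1' orbT.
- apply: leq_trans (weightU _ _) _.
  rewrite weight1 (weightD1 SF) (weightD1 SF1) cardsU.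
  have := tight_card SF; have := tight_card SF'; card_lia.
- rewrite cardsU1 [ltnRHS](cardsD1 S) SF [X in _ < _ + X](cardsD1 S') SF1.
  by case: (_ \notin _); lia.
Qed.

Lemma tight_eq S S' x y :
  S \in F -> S' \in F -> x != y ->
  x \in S -> y \in S -> x \in S' -> y \in S' -> S = S'.
Proof.
move=> SF SF' xy xS yS xS' yS'; apply/eqP; apply: contraT => nSS.
have := tight_linear SF SF' nSS; rewrite leqNgt => /negP; case.
by apply/card_gt1P; exists x, y; rewrite !inE xS yS xS' yS'.
Qed.

(* Otherwise [y] could be added to [S1] and [S2] dropped from the family. *)
Lemma tight_exchange S1 S2 x y z :
  S1 \in F -> S2 \in F -> S1 != S2 -> #|S2| = 3 ->
  x \in S2 -> y \in S2 -> x != y -> ~~ x -- y ->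
  x \in S1 -> z \in S1 -> ~~ y -- z.
Proof.
move=> SF1 SF2 nS c2 xS2 yS2 xy nxy xS1 zS1; apply/negP => yz.
have SF1' : S1 \in F :\ S2 by rewrite !inE nS.
apply: (@tight_no_smaller ((y |: S1) |: (F :\ S2 :\ S1))).
- apply/coveringP; split=> [S /setU1P[->|]|u v uv nuv].
  + by apply: linkedU1 yz; rewrite ?tight_linked.
  + by move=> /setD1P[_ /setD1P[_ /tight_linked]].
  have [S [SF uS vS]] := tight_cover uv nuv.
  case: (eqVneq S S2) => [SS|h2].
    rewrite SS in uS vS.
    (* The triple [S2] has [x], [y] as its only nonadjacent pair, and both now lie in [y |: S1]. *)
    have uvE := linked3_nadj (tight_linked SF2) c2 uS vS uv nuv xS2 yS2 xy nxy.
    have suv : [set u; v] \subset y |: S1.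
      by rewrite uvE subUset !sub1set setU11 setU1r.
    by exists (y |: S1); rewrite setU11 !(subsetP suv) ?inE ?eqxx ?orbT.
  case: (eqVneq S S1) => [SS|h1].
    by exists (y |: S1); rewrite -SS setU11 !inE uS vS !orbT.
  by exists S; rewrite !inE h1 h2 SF orbT.
(* The vertex [y] adds at most one to the weight of [S1], and the dropped triple had weight one. *)
- apply: leq_trans (weightU _ _) _.
  rewrite weight1 (weightD1 SF2) (weightD1 SF1') cardsU1 c2.
  by have := tight_card SF1; case: (_ \notin _); card_lia.
- rewrite cardsU1 [ltnRHS](cardsD1 S2) SF2 [X in _ < _ + X](cardsD1 S1) SF1'.
  by case: (_ \notin _); card_lia.
Qed.

Lemma mc_tight : mc G + weight F = #|edges G|.
Proof.
have [cF Fm] := tF.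
have [c [mcc nc]] := covering_mc_coloring cF tight_linear tight_card.
have ncm := ncolors_le_mc mcc.
suff : mc G <= #|edges G| - weight F.
  (* This cover yields [weight F <= #|edges G|], which makes the truncated subtraction exact. *)
  have [F' [cF' nF']] := mc_coloring_covering mcc.
  by case: (Fm F' cF'); card_lia.
apply/bigmax_leqP => c' mcc'; have [F' [cF' nF']] := mc_coloring_covering mcc'.
by case: (Fm F' cF'); card_lia.
Qed.

Lemma tight_le F' : covering F' -> weight F <= weight F'.
Proof. by case: tF => _ /(_ F') h /h; card_lia. Qed.

End Tight.
End Weights.

(** * Upper bounds on the weight of a cover *)

Section Bounds.
Variable G : sgraph.
Implicit Types (x y z : G) (S X Y P U W : {set G}) (E F : {set {set G}}).

Lemma weight_imset (I : finType) (A : {set I}) (f : I -> {set G}) :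
  weight (f @: A) <= \sum_(i in A) (#|f i| - 2).
Proof.
have -> : f @: A = \bigcup_(i in A) [set f i].
  apply/setP => S; apply/imsetP/bigcupP => -[i iA].
    by move=> ->; exists i; rewrite ?set11.
  by move/set1P->; exists i.
apply: leq_trans (weight_bigcup _ _) _.
by apply: leq_sum => i _; rewrite weight1.
Qed.

(** The members [v |: U i] have weight [#|U i| - 1] each, in total at most [#|G| - 1 - s]. The value
    [s = k] serves k-perfectly-connected graphs, and [s = k - 1] the first class, at the price of
    one unit. *)
Lemma parts_weight s (v : G) (U : 'I_s -> {set G}) :
  pointed_partition v U -> (forall i, linked (v |: U i)) ->
  complete_multipartite U -> exists F, covering F /\ weight F + s < #|G|.
Proof.
move=> [U0 vU dU UT] lU cU; exists [set v |: U i | i in [set: 'I_s]]; split.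
  apply/coveringP; split=> [_ /imsetP[i _ ->] //|x y xy nxy].
  have inU z : z != v -> exists i, z \in U i.
    by move=> zv; have := in_setT z; rewrite -UT !inE (negPf zv) => /bigcupP[i _ zi]; exists i.
  have FI i : v |: U i \in [set v |: U i | i in [set: 'I_s]] by apply/imsetP; exists i.
  have [xv|/inU[i xi]] := eqVneq x v.
    have [|i yi] := inU y; first by rewrite -xv eq_sym.
    by exists (v |: U i); rewrite FI xv setU11 setU1r.
  have [yv|/inU[j yj]] := eqVneq y v.
    by exists (v |: U i); rewrite FI yv setU11 setU1r.
  exists (v |: U i); rewrite FI !setU1r //.
  by have [->//|ij] := eqVneq i j; rewrite (cU _ _ ij) in nxy.
have := @partition_disjoint_bigcup _ _ _ _ addn U (fun=> 1) dU; rewrite sum1_card => cU1.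
have vn : v \notin \bigcup_i U i by apply/negP => /bigcupP[i _]; apply/negP.
have := cardsU1 v (\bigcup_i U i); rewrite UT cardsT vn cU1 => ->.
rewrite addnC add1n ltnS.
apply: leq_trans (_ : s + \sum_(i < s) (#|v |: U i| - 2) <= _).
  rewrite leq_add2l; have := weight_imset [set: 'I_s] (fun i => v |: U i).
  by move/leq_trans; apply; rewrite (eq_bigl xpredT) // => i; rewrite inE.
rewrite -[X in X + _]card_ord -sum1_card -big_split /=; apply: leq_sum => i _.
rewrite cardsU1 vU sum1_card; have := U0 i; rewrite -card_gt0; lia.
Qed.

Lemma perfectly_connected_weight s : perfectly_connected G s ->
  exists F, covering F /\ weight F + s < #|G|.
Proof.
case=> v [V [pV cV mV nV]]; apply: parts_weight pV _ mV => i.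
have /connected_induced[_ lV] := cV i.
have /card_gt0P[y] : 0 < #|nbrs_in v (V i)| by rewrite nV.
by rewrite inE => /andP[yV vy]; apply: linkedU1 lV yV vy.
Qed.

Lemma iso_card (F H : sgraph) : iso F H -> #|F| = #|H|.
Proof. by case=> f fB _; apply: bij_eq_card fB. Qed.

Lemma is_complete_adj p (U : {set G}) : is_complete p (induced U) ->
  #|U| = p /\ {in U &, forall x y, x != y -> x -- y}.
Proof.
move=> c; have := iso_card c; rewrite card_induced card_ord; split=> //.
case: c => f fB fE x y xU yU xy.
rewrite -[x]/(val (Sub x xU : induced U)) -[y]/(val (Sub y yU : induced U)).
change (is_true ((Sub x xU : induced U) -- Sub y yU)).
rewrite -fE /= /complete_adj (inj_eq (bij_inj fB)) -val_eqE /=.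
exact: xy.
Qed.

Lemma is_complete_minus_nadj p (U : {set G}) : is_complete_minus p (induced U) ->
  #|U| = p /\ exists a b, [/\ a \in U, b \in U &
    {in U &, forall x y, x != y -> ~~ x -- y -> [set x; y] = [set a; b]}].
Proof.
case=> -[a b] /= ab c; have := iso_card c; rewrite card_induced card_ord; split=> //.
case: c => f [g fK gK] fE; exists (val (g a)), (val (g b)).
split; rewrite ?(valP (g a)) ?(valP (g b)) // => x y xU yU xy nxy.
have := fE (Sub x xU) (Sub y yU).
have -> : (Sub x xU : induced U) -- Sub y yU = false by apply/negbTE.
move=> /negbT; rewrite /= /del_edge_adj /= /complete_adj (can_eq fK) -val_eqE /= xy /=.
rewrite negbK => /eqP e.
have fx z (zU : z \in U) : z = val (g (f (Sub z zU))) by rewrite fK.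
have : f (Sub x xU) \in [set a; b] /\ f (Sub y yU) \in [set a; b].
  by rewrite -e !inE !eqxx orbT.
have fxy : f (Sub x xU) != f (Sub y yU) by rewrite (can_eq fK) -val_eqE.
rewrite [in LHS](fx x xU) [in LHS](fx y yU).
case=> /set2P[]ex /set2P[]ey; move: fxy; rewrite ex ey ?eqxx // => _.
by rewrite setUC.
Qed.

Lemma join_partition_card U W : join_partition U W -> #|G| = #|U| + #|W|.
Proof.
by case=> _ _ d UT _; rewrite -cardsT -UT cardsU disjoint_setI0 // cards0 subn0.
Qed.

Lemma join_partition_nadj U W x y : join_partition U W -> ~~ x -- y ->
  (x \in W /\ y \in W) \/ (x \in U /\ y \in U).
Proof.
case=> _ _ _ UT aUW nxy.
have inUW z : (z \in U) || (z \in W) by rewrite -in_setU UT inE.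
case/orP: (inUW x) => xI; case/orP: (inUW y) => yI; [by right| | |by left].
  by rewrite (aUW x y) in nxy.
by rewrite adj_sym (aUW y x) in nxy.
Qed.

(** All nonadjacent pairs lie in [W], so it suffices as single member. For the second class
    [p = k - 2], and the bound is [n - k]. *)
Lemma join_complete_weight p U W :
  join_partition U W -> is_complete p (induced U) -> connected (induced W) ->
  exists F, covering F /\ weight F <= #|G| - p - 2.
Proof.
move=> jUW cU /connected_induced[_ lW].
have [<- aU] := is_complete_adj cU; exists [set W]; split.
  apply/coveringP; split=> [S /set1P->//|x y xy nxy].
  exists W; rewrite set11; case: (join_partition_nadj jUW nxy) => -[xI yI] //.
  by rewrite aU in nxy.
by rewrite weight1 (join_partition_card jUW) addnC addnK.
Qed.

(** The missing edge of [U] is covered by a triple whose middle vertex is any [w] in [W]; this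
    triple accounts for the final 1. For the third class [p = k - 1], and the bound is again
    [n - k]. *)
Lemma join_complete_minus_weight p U W :
  join_partition U W -> is_complete_minus p (induced U) ->
  connected (induced W) ->
  exists F, covering F /\ weight F <= #|G| - p - 2 + 1.
Proof.
move=> jUW cU /connected_induced[W0 lW].
have [<- [a [b [aU bU abU]]]] := is_complete_minus_nadj cU.
have [w wW] := set0Pn _ W0; have [_ _ _ _ aUW] := jUW.
exists ([set W] :|: [set [set a; b; w]]); split.
  apply/coveringP; split=> [S /setUP[]/set1P->//|x y xy nxy].
    have -> : [set a; b; w] = a |: [set b; w] by rewrite setUA.
    apply: (@linkedU1 _ _ _ w); rewrite ?inE ?eqxx ?orbT ?aUW //.
    by apply: linked2; apply: aUW.
  case: (join_partition_nadj jUW nxy) => -[xI yI].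
    by exists W; rewrite !inE eqxx.
  exists [set a; b; w]; rewrite -(abU x y) //.
  by rewrite !inE !eqxx !orbT.
apply: leq_trans (weightU _ _) _.
rewrite !weight1 (join_partition_card jUW).
have : #|[set a; b; w]| <= 3.
  by rewrite -setUA; apply: leq_trans (leq_card_setU _ _) _; rewrite cards1 cards2; case: (_ != _).
have : 0 < #|W| by rewrite card_gt0.
lia.
Qed.

(** The copy of [H] in [G] is the only member, of weight [n - k - 1]. *)
Lemma class_A_weight n k : #|G| = n -> 0 < k < n -> class_A G n k ->
  exists F, covering F /\ weight F + k < n.
Proof.
move=> Gn /andP[k0 kn] [H [cH cardH _ [f [g fK gK] fE]]].
pose h (z : H) : G := g (inr z).
have hI : injective h by move=> u v /(can_inj gK)[].
have hE u v : h u -- h v = u -- v by rewrite /h -fE !gK.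
have lS : linked (h @: setT).
  by rewrite linked_imset //; case/connectedE: cH.
exists [set h @: setT]; split.
  apply/coveringP; split=> [S /set1P->//|x y xy nxy].
  exists (h @: setT); rewrite set11; move: nxy; rewrite -fE.
  have := fK x; have := fK y; have : f x != f y by rewrite (can_eq fK).
  case: (f x) => x'; case: (f y) => y' //=.
    by rewrite /complete_adj => + _ _ /negbNE/eqP e; rewrite e eqxx.
  by move=> _ <- <- _; rewrite !imset_f.
by rewrite weight1 card_imset // cardsT cardH; lia.
Qed.

End Bounds.

(** * Sets crossing a cut *)

Section Crossing.
Variable G : sgraph.
Implicit Types (x y z : G) (S X Y P A B : {set G}) (E F : {set {set G}}).

Definition crossing A B S := (0 < #|S :&: A|) && (0 < #|S :&: B|).

(** The number of edges of a spanning tree of the complete bipartite graph between the two traces of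
    [S]. *)
Definition span A B S :=
  if crossing A B S then #|S :&: A| + #|S :&: B| - 1 else 0.

Definition total_span F A B := \sum_(S in F) span A B S.

Definition star F A y := [set S in F | (y \in S) && (0 < #|S :&: A|)].

Definition covers F A B :=
  forall x y, x \in A -> y \in B -> exists S, [/\ S \in F, x \in S & y \in S].

Lemma crossing_mem A B S x y :
  x \in A -> x \in S -> y \in B -> y \in S -> crossing A B S.
Proof.
move=> xA xS yB yS; apply/andP; split; apply/card_gt0P.
  by exists x; rewrite inE xS.
by exists y; rewrite inE yS.
Qed.

(** The inequality is strict exactly when [S] meets [B] in [y] only and [A] in more than one vertex;
    [total_span_neq] exploits this. *)
Lemma span_step A B S y : y \in B ->
  span A (B :\ y) S + ((y \in S) && (0 < #|S :&: A|)) <= span A B S.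
Proof.
move=> yB; rewrite /span /crossing.
have -> : #|S :&: B| = (y \in S) + #|S :&: (B :\ y)|.
  by rewrite (cardsD1 y) inE yB andbT setIDA.
by case: (y \in S); case: #|S :&: A| => [|a]; case: #|S :&: (B :\ y)| => [|b] //=; lia.
Qed.

Lemma total_span_step F A B y : y \in B ->
  total_span F A (B :\ y) + #|star F A y| <= total_span F A B.
Proof.
move=> yB; rewrite /total_span /star cardsE -sum1_card big_mkcondr /= -big_split /=.
apply: leq_sum => S _; apply: leq_trans (span_step A S yB).
by case: (_ && _).
Qed.

Lemma covers_star F A B y : covers F A B -> A != set0 -> y \in B ->
  0 < #|star F A y|.
Proof.
move=> cF /set0Pn[x xA] yB; have [S [SF xS yS]] := cF x y xA yB.
apply/card_gt0P; exists S; rewrite inE SF yS; apply/card_gt0P.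
by exists x; rewrite inE xS.
Qed.

(** For disjoint sides, spanning trees of the bipartite pieces together connect [A :|: B], which
    takes at least as many edges as a tree. The induction removes the vertices of [B] one by one,
    each at a cost of at least one. *)
Lemma total_span_ge F A B : covers F A B -> A != set0 -> B != set0 ->
  #|A| + #|B| - 1 <= total_span F A B.
Proof.
move=> + A0; have [n] := ubnP #|B|; elim: n B => // n IH B; rewrite ltnS => Bn cF.
case/set0Pn => y yB; have [By|By] := eqVneq (B :\ y) set0.
  have -> : #|B| = 1 by rewrite (cardsD1 y) yB By cards0.
  rewrite addnK; apply: leq_trans (_ : #|\bigcup_(S in F | y \in S) (S :&: A)| <= _).
    apply: subset_leq_card; apply/subsetP => x xA.
    have [S [SF xS yS]] := cF x y xA yB.
    by apply/bigcupP; exists S; rewrite ?SF ?inE ?xS.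
  rewrite /total_span [leqRHS](bigID (fun S : {set G} => y \in S)) /=.
  apply: leq_trans (leq_addr _ _).
  apply: (big_ind2 (fun (X : {set G}) m => #|X| <= m)); first by rewrite cards0.
    by move=> X m Y p hX hY; apply: leq_trans (leq_card_setU _ _) (leq_add hX hY).
  move=> S /andP[_ yS]; rewrite /span /crossing.
  have : 0 < #|S :&: B| by apply/card_gt0P; exists y; rewrite inE yS.
  by case: #|S :&: B| => // b _; case: #|S :&: A| => //= a; lia.
have cB : #|B| = #|B :\ y|.+1 by rewrite (cardsD1 y) yB.
have := total_span_step F A yB; have := covers_star cF A0 yB.
have := IH (B :\ y) _ _ By; rewrite -ltnS -cB ltnS => /(_ Bn) h.
have /h : covers F A (B :\ y) by move=> u w uA /setD1P[_ wB]; apply: cF.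
lia.
Qed.

(** The member joining [y] to some vertex of [A] must then join it to all of [A]. Two members
    containing [A] agree by linearity, because [A] has two vertices. *)
Lemma star_le1_subset F A B S :
  linear F -> covers F A B -> 1 < #|A| ->
  (forall y, y \in B -> #|star F A y| <= 1) ->
  S \in F -> crossing A B S -> A :|: B \subset S.
Proof.
move=> lF cF A2 st1 SF cS.
have sA y S' : y \in B -> S' \in F -> y \in S' -> 0 < #|S' :&: A| -> A \subset S'.
  move=> yB S'F yS' S'A; apply/subsetP => x xA.
  have [T [TF xT yT]] := cF x y xA yB.
  have /card_le1_eqP e := st1 y yB.
  rewrite -(e S' T) // inE ?S'F ?yS' // TF yT.
  by apply/card_gt0P; exists x; rewrite inE xT.
have /card_gt0P[x xA] : 0 < #|A| by apply: ltnW.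
have /andP[SA /card_gt0P[z /setIP[zS zB]]] := cS.
have AS := sA z S zB SF zS SA; rewrite subUset AS; apply/subsetP => y yB.
have [T [TF xT yT]] := cF x y xA yB.
have AT : A \subset T.
  by apply: sA yB TF yT _; apply/card_gt0P; exists x; rewrite inE xT.
have [<-//|TS] := eqVneq T S.
have := lF T S TF SF TS; rewrite leqNgt => /negP; case.
by apply: leq_trans A2 (subset_leq_card _); rewrite subsetI AT.
Qed.

(** The lower bound for [B :\ y] is only one below the total, which leaves no room for a second
    member in the star of [y]. *)
Lemma total_span_min F A B S :
  linear F -> covers F A B -> 1 < #|A| -> 1 < #|B| ->
  total_span F A B <= #|A| + #|B| - 1 ->
  S \in F -> crossing A B S -> A :|: B \subset S.
Proof.
move=> lF cF A2 B2 mF; apply: star_le1_subset => // y yB.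
have := total_span_step F A yB.
have cB : #|B| = #|B :\ y|.+1 by rewrite (cardsD1 y) yB.
have := @total_span_ge F A (B :\ y).
rewrite -!card_gt0 => /(_ _ _ _)h.
have : #|A| + #|B :\ y| - 1 <= total_span F A (B :\ y).
  by apply: h; [move=> u w uA /setD1P[_ wB]; apply: cF|apply: ltnW|rewrite -ltnS -cB].
by move: mF; rewrite cB; lia.
Qed.

Lemma total_span_single F A B S :
  S \in F -> A :|: B \subset S -> A != set0 -> B != set0 ->
  (forall T, T \in F -> crossing A B T -> T = S) ->
  total_span F A B = #|A| + #|B| - 1.
Proof.
rewrite subUset => SF /andP[/setIidPr SA /setIidPr SB] A0 B0 uS.
rewrite /total_span (big_setD1 S) //= big1 ?addn0.
  by rewrite /span /crossing SA SB !card_gt0 A0 B0.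
move=> T /setD1P[TS TF]; rewrite /span; case: ifP => // cT.
by rewrite (uS T TF cT) eqxx in TS.
Qed.

(** Rules out slack in the span when all members cross with a single vertex outside [A :|: B]. A
    total one above the minimum produces a vertex [y] of [B] in exactly two members, and these turn
    out to share a second vertex, against linearity. *)
Lemma total_span_neq F A B : tight F -> [disjoint A & B] ->
  {in A & B, forall x y, ~~ x -- y} -> 1 < #|A| -> 1 < #|B| ->
  (forall S, S \in F -> crossing A B S /\ #|S| = #|S :&: A| + #|S :&: B| + 1) ->
  total_span F A B != #|A| + #|B|.
Proof.
move=> tF dAB nAB A2 B2 crF; apply/eqP => tot.
have neqAB x y : x \in A -> y \in B -> x != y.
  by move=> xA yB; apply/eqP => xy; rewrite -xy (disjointFr dAB xA) in yB.
have cF : covers F A B.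
  by move=> x y xA yB; apply: (tight_cover tF); [apply: neqAB | apply: nAB].
have A0 : A != set0 by rewrite -card_gt0 ltnW.
have B0 : B != set0 by rewrite -card_gt0 ltnW.
have lF := tight_linear tF.
have cB y : y \in B -> #|B| = #|B :\ y|.+1 by move=> yB; rewrite (cardsD1 y) yB.
have cFD y : covers F A (B :\ y) by move=> u w uA /setD1P[_ wB]; apply: cF.
have geD y : y \in B -> #|A| + #|B| - 2 <= total_span F A (B :\ y).
  move=> yB; have := @total_span_ge F A (B :\ y) (cFD y) A0.
  rewrite -card_gt0 -ltnS -(cB y yB) => /(_ B2); have := cB y yB; card_lia.
have starS y S : y \in B -> y \in S -> S \in F -> S \in star F A y.
  by move=> yB yS SF; rewrite inE SF yS; have [/andP[-> _] _] := crF S SF.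
have star2 y : y \in B -> #|star F A y| <= 2.
  move=> yB; have := total_span_step F A yB; have := geD y yB; rewrite tot.
  by move: (total_span _ _ _) => t; lia.
(* Otherwise one member would contain [A :|: B] and be the only crossing one, and the total would be
   minimal. *)
have [y yB sty] : exists2 y, y \in B & 1 < #|star F A y|.
  apply/exists_inP; apply: contraT => /exists_inPn h.
  have [x xA] := set0Pn _ A0; have [y yB] := set0Pn _ B0.
  have [S [SF xS yS]] := cF x y xA yB.
  have sub T : T \in F -> crossing A B T -> A :|: B \subset T.
    by apply: star_le1_subset => // z /h; rewrite -leqNgt.
  have ABS := sub S SF (crossing_mem xA xS yB yS).
  have := @total_span_single F A B S SF ABS A0 B0.
  rewrite tot => /(_ _)h2.
  have : #|A| + #|B| = #|A| + #|B| - 1; last by card_lia.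
  apply: h2 => T TF cT; have := sub T TF cT; rewrite !subUset in ABS *.
  case/andP: ABS => AS _ /andP[AT _]; apply/eqP; apply: contraT => nTS.
  have := lF T S TF SF nTS; rewrite leqNgt => /negP; case.
  by apply: leq_trans A2 (subset_leq_card _); rewrite subsetI AT.
(* With two members in the star, the bounds for [B] and [B :\ y] leave no slack, so [span_step] is
   an equality for both. *)
have spanE S : S \in star F A y -> span A B S <= (span A (B :\ y) S).+1.
  have h : total_span F A B <= total_span F A (B :\ y) + #|star F A y|.
    by move: (geD y yB) (star2 y yB) sty; rewrite tot; lia.
  move: h; rewrite /total_span /star cardsE -sum1_card big_mkcondr /= -big_split /=.
  rewrite inE => h /andP[SF stS].
  rewrite leqNgt; apply/negP => lt; move: h; rewrite leqNgt => /negP; case.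
  rewrite (big_setD1 S) //= [ltnRHS](big_setD1 S) //= stS addn1 -addSn.
  apply: leq_add => //; apply: leq_sum => T _; apply: leq_trans (span_step A T yB).
  by case: (_ && _).
(* A member of the star meeting [B] only in [y] would be a triple containing one [x] of [A]. Let [T]
   join [x] to another vertex of [B]. By the exchange, [y] is adjacent to no vertex of [T], so
   different members join [y] to the at least three vertices of [T], contrary to [star2]. *)
have meets S : S \in star F A y -> 0 < #|S :&: (B :\ y)|.
  move=> stS; rewrite lt0n; apply/eqP => SB0.
  have := spanE S stS; rewrite {2}/span /crossing SB0 andbF /=.
  move: (stS); rewrite inE => /and3P[SF yS SA].
  have [cS cardS] := crF S SF; rewrite /span cS.
  have SB1 : #|S :&: B| = 1.
    by rewrite (cardsD1 y) inE yS yB -setIDA SB0.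
  rewrite SB1 addnK => SA1; have {}SA1 : #|S :&: A| = 1 by apply/eqP; rewrite eqn_leq SA1.
  have S3 : #|S| = 3 by rewrite cardS SA1 SB1.
  have /card_gt0P[x /setIP[xS xA]] := SA.
  have /card_gt0P[w /setD1P[wy wB]] : 0 < #|B :\ y| by rewrite -ltnS -(cB y yB).
  have [T [TF xT wT]] := cF x w xA wB.
  have TS : T != S.
    apply/eqP => TS; suff : w \in S :&: (B :\ y) by rewrite (cards0_eq SB0) inE.
    by rewrite !inE wy wB -TS wT.
  have xy := neqAB x y xA yB.
  have yT : y \notin T.
    by apply/negP => yT; case/eqP: TS; apply: (tight_eq tF _ _ xy).
  have exch z : z \in T -> ~~ y -- z.
    by apply: (tight_exchange tF TF SF TS S3 xS yS xy (nAB x y xA yB) xT).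
  have /fin_all_exists[p pP] z : exists S', z \in T -> [/\ S' \in F, y \in S' & z \in S'].
    case: (boolP (z \in T)) => [zT|_]; last by exists S.
    have [|S' h] := tight_cover tF (_ : y != z) (exch z zT); last by exists S'.
    by apply/eqP => yz; rewrite yz zT in yT.
  have pI : {in T &, injective p}.
    move=> z t zT tT pzt; apply/eqP; apply: contraT => zt.
    have [pF yp zp] := pP z zT; have [_ _ tp] := pP t tT.
    rewrite -pzt in tp; case/negP: yT.
    by rewrite -(tight_eq tF pF TF zt).
  have := star2 y yB; rewrite leqNgt => /negP; case.
  apply: leq_trans (tight_card tF TF) _; rewrite -(card_in_imset pI).
  apply: subset_leq_card; apply/subsetP => _ /imsetP[z zT ->].
  by have [pF yp _] := pP z zT; apply: starS.
have /card_gt1P[S [T [stS stT nST]]] := sty.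
have [SF yS SA] : [/\ S \in F, y \in S & 0 < #|S :&: A|] by move: stS; rewrite inE => /and3P.
have [TF yT TA] : [/\ T \in F, y \in T & 0 < #|T :&: A|] by move: stT; rewrite inE => /and3P.
have SBy := meets S stS; have TBy := meets T stT.
have common z : z != y -> z \in S -> z \in T -> False.
  by move=> zy zS zT; case/eqP: nST; apply: (tight_eq tF SF TF zy).
have [B1|B1] := leqP #|B :\ y| 1.
  move/card_gt0P: SBy => [z /setIP[zS zB]]; move/card_gt0P: TBy => [t /setIP[tT tB]].
  have zt : z = t by move/card_le1_eqP: B1 => /(_ z t zB tB).
  by apply: (@common z) => //; [case/setD1P: zB | rewrite zt].
(* Removing [y] cost at least two, so the span for [B :\ y] is minimal and both members contain
   [A]. *)
have sp : total_span F A (B :\ y) <= #|A| + #|B :\ y| - 1.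
  have := total_span_step F A yB; rewrite tot; have := cB y yB; move: sty.
  by move: (total_span _ _ _) => t; lia.
have subs R : R \in F -> crossing A (B :\ y) R -> A \subset R.
  move=> RF cR; have := total_span_min lF (cFD y) A2 B1 sp RF cR.
  by rewrite subUset => /andP[].
have /card_gt0P[x xA] : 0 < #|A| by apply: ltnW.
apply: (@common x); first exact: neqAB.
  by apply: (subsetP (subs S SF _)) => //; rewrite /crossing SA.
by apply: (subsetP (subs T TF _)) => //; rewrite /crossing TA.
Qed.

End Crossing.

(** * A vertex of degree k *)

Section Excess.
Variable G : sgraph.
Variables (F : {set {set G}}) (A B : {set G}).
Hypothesis tF : tight F.
Hypothesis dAB : [disjoint A & B].
Hypothesis nAB : {in A & B, forall x y, ~~ x -- y}.
Implicit Types (x y z : G) (S : {set G}).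

(** The part of the weight of [S] not counted in its span. The subtraction is exact for crossing
    members, since [crossing_outside] puts one of their vertices in the cut. *)
Definition excess S :=
  if crossing A B S then #|S :\: (A :|: B)| - 1 else #|S| - 2.

Lemma card_split S : #|S| = #|S :&: A| + #|S :&: B| + #|S :\: (A :|: B)|.
Proof.
rewrite -(cardsID (A :|: B) S) setIUr cardsU (_ : S :&: A :&: (S :&: B) = set0).
  by rewrite cards0 subn0.
apply/setP => x; rewrite !inE; case: (boolP (x \in A)) => [xA|]; last by rewrite andbF.
by rewrite (disjointFr dAB xA) !andbF.
Qed.

Lemma crossing_outside S : S \in F -> crossing A B S -> 0 < #|S :\: (A :|: B)|.
Proof.
move=> SF /andP[/card_gt0P[x /setIP[xS xA]] /card_gt0P[y /setIP[yS yB]]].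
have yA : y \notin A by rewrite (disjointFl dAB yB).
have [u [w [uS uA wS wA uw]]] := linked_split (tight_linked tF SF) xS xA yS yA.
apply/card_gt0P; exists w; rewrite !inE wS andbT (negPf wA) /=.
by apply: contraTN uw => wB; apply: nAB.
Qed.

Lemma weight_excess : weight F = total_span F A B + \sum_(S in F) excess S.
Proof.
rewrite /weight /total_span -big_split /=; apply: eq_bigr => S SF.
rewrite /span /excess; case: ifP => // cS.
have := crossing_outside SF cS; have := card_split S.
have /andP[] := cS; card_lia.
Qed.

Lemma excess0 S : S \in F -> excess S = 0 ->
  crossing A B S /\ #|S :\: (A :|: B)| = 1.
Proof.
move=> SF; rewrite /excess; case: ifP => cS.
  by have := crossing_outside SF cS; move=> h1 h2; split=> //; card_lia.
by have := tight_card tF SF; card_lia.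
Qed.

Lemma excess1 S : S \in F -> excess S = 1 ->
  crossing A B S /\ #|S :\: (A :|: B)| = 2 \/ ~~ crossing A B S /\ #|S| = 3.
Proof.
move=> SF; rewrite /excess; case: ifP => cS.
  by have := crossing_outside SF cS; move=> h1 h2; left; split=> //; card_lia.
by have := tight_card tF SF; move=> h1 h2; right; split=> //; card_lia.
Qed.

Lemma sum_excess1 : \sum_(S in F) excess S = 1 ->
  exists2 S, S \in F /\ excess S = 1 &
    forall T, T \in F -> T != S -> excess T = 0.
Proof.
move=> s1; have [S SF eS] : exists2 S, S \in F & 0 < excess S.
  apply/exists_inP; apply: contraT => /exists_inPn h.
  by rewrite big1 // in s1 => S /h; rewrite lt0n negbK => /eqP.
move: s1; rewrite (big_setD1 S) //= => s1.
have eS1 : excess S = 1 by move: s1 eS; move: (excess S) (\sum_(_ in _) _); clear; lia.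
exists S => // T TF TS; move/eqP: s1; rewrite eS1 -[1 in X in _ == X]addn0 eqn_add2l.
by rewrite sum_nat_eq0 => /forall_inP/(_ T); rewrite !inE TS TF => /(_ isT)/eqP.
Qed.

End Excess.

(** * Partitions obtained from a vertex with k neighbours *)

Section Labels.
Variable G : sgraph.
Implicit Types (x y z v l : G) (S L : {set G}).

Lemma parts_of_labels s v (h : G -> G) L : #|L| = s ->
  (forall x, x != v -> h x \in L) ->
  (forall l, l \in L -> exists2 x, x != v & h x = l) ->
  (forall x y, x != v -> y != v -> x != y -> ~~ x -- y -> h x = h y) ->
  exists (lab : 'I_s -> G) (U : 'I_s -> {set G}),
    [/\ injective lab, forall i, lab i \in L,
        forall l, l \in L -> exists i, lab i = l,
        forall i, U i = [set x | x != v & h x == lab i]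
      & pointed_partition v U /\ complete_multipartite U].
Proof.
move=> Ls hL Lh hn; pose lab (i : 'I_s) := enum_val (cast_ord (esym Ls) i).
have labI : injective lab by move=> i j /enum_val_inj/cast_ord_inj.
have labL i : lab i \in L by apply: enum_valP.
have Llab l : l \in L -> exists i, lab i = l.
  move=> lL; exists (cast_ord Ls (enum_rank_in lL l)).
  by rewrite /lab cast_ordK enum_rankK_in.
pose U i := [set x | x != v & h x == lab i].
exists lab, U; split=> //; split.
  split=> [i|i|i j ij|].
  - by have [x xv hx] := Lh _ (labL i); apply/set0Pn; exists x; rewrite inE xv hx /=.
  - by rewrite inE eqxx.
  - apply/pred0P => x /=; rewrite !inE; apply/negP => /andP[/andP[_ /eqP->] /andP[_ /eqP/labI e]].
    by rewrite e eqxx in ij.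
  - apply/setP => x; rewrite !inE; case: eqP => //= /eqP xv.
    have [i li] := Llab _ (hL x xv).
    by apply/bigcupP; exists i; rewrite // inE xv li /=.
move=> i j ij x y; rewrite !inE => /andP[xv /eqP hx] /andP[yv /eqP hy].
have hxy : h x != h y by rewrite hx hy (inj_eq labI).
apply: contraNT hxy => nxy; apply/eqP; apply: hn => //.
by apply: contraNneq ij => xy; rewrite -(inj_eq labI) -hx -hy xy.
Qed.

Section Apex.
Variables (k : nat) (v : G) (F : {set {set G}}).
Hypothesis tF : tight F.
Let N := [set y | v -- y].
Let B := ~: (v |: N).
Hypothesis cN : #|N| = k.

Let dvB : [disjoint [set v] & B].
Proof. by rewrite disjoints1 !inE eqxx. Qed.

Let nvB : {in [set v] & B, forall x y, ~~ x -- y}.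
Proof. by move=> x y /set1P->; rewrite !inE negb_or => /andP[]. Qed.

Let outN S : S :\: ([set v] :|: B) = S :&: N.
Proof.
apply/setP => x; rewrite !inE; case: eqP => [->|_] /=; first by rewrite adj_irrefl andbF.
by rewrite negbK andbC.
Qed.

Let crossv S : crossing [set v] B S -> v \in S.
Proof. by case/andP => /card_gt0P[x /setIP[xS /set1P<-]]. Qed.

(** Vertices are grouped by neighbours of [v]. A nonneighbour [x] lies with [v] in a member, unique
    by linearity, and linkedness gives this member a neighbour of [v]; the default can arise at most
    for [x = v]. *)
Definition apex_label x :=
  if v -- x then x
  else odflt v [pick l | v -- l & [exists S in F, [&& v \in S, x \in S & l \in S]]].

Lemma apex_labelN x : v -- x -> apex_label x = x.
Proof. by rewrite /apex_label => ->. Qed.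

Lemma apex_labelP x : x != v ->
  v -- apex_label x /\
  (v -- x = false -> exists S, [/\ S \in F, v \in S, x \in S & apex_label x \in S]).
Proof.
move=> xv; rewrite /apex_label; case: ifP => // nvx.
case: pickP => [l /andP[vl /exists_inP[S SF /and3P[vS xS lS]]]|none].
  by split=> // _; exists S.
have [||S [SF vS xS]] := tight_cover tF (_ : v != x); rewrite ?nvx 1?eq_sym //.
have xv1 : x \notin [set v] by rewrite inE.
have [u [l [uS /set1P uv lS _]]] := linked_split (tight_linked tF SF) vS (set11 v) xS xv1.
rewrite uv => vl; have := none l; rewrite vl => /exists_inPn/(_ S SF).
by rewrite vS xS lS.
Qed.

Lemma apex_label_in S x : S \in F -> v \in S -> x \in S -> x != v ->
  apex_label x \in S :&: N.
Proof.
move=> SF vS xS xv; have [vg gS] := apex_labelP xv; rewrite !inE vg andbT.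
case vx : (v -- x); first by rewrite apex_labelN.
have [T [TF vT xT gT]] := gS vx.
by rewrite (tight_eq tF SF TF xv).
Qed.

Section Coarser.
Variable h : G -> G.
Hypothesis hcross : forall S x y, S \in F -> crossing [set v] B S ->
  x \in S -> y \in S -> x != v -> y != v -> h x = h y.

(** A nonneighbour of [v] reaches [v] inside a crossing member, on which [h] is constant away from
    [v]. The map [h] will be [apex_label], or [apex_label] with two labels identified. *)
Lemma apex_fibre_linked l : linked (v |: [set y | y != v & h y == l]).
Proof.
apply: (@linked_from _ _ v) => y /setU1P[->//|yl].
have := yl; rewrite inE => /andP[yv /eqP hy].
case vy : (v -- y).
  by apply: connect1; rewrite /adjin setU11 setU1r.
have [_ /(_ vy)[S [SF vS yS _]]] := apex_labelP yv.
have cS : crossing [set v] B S.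
  by apply: (@crossing_mem _ _ _ _ v y); rewrite ?set11 // !inE (negPf yv) vy.
apply: (@connect_adjinS _ S); last by apply/linkedP; rewrite ?(tight_linked tF SF).
apply/subsetP => z zS; rewrite !inE; case: (eqVneq z v) => //= zv.
by rewrite -hy (hcross SF cS zS yS).
Qed.

Hypothesis hnoncross : forall S x y, S \in F -> ~~ crossing [set v] B S ->
  x \in S -> y \in S -> x != v -> y != v -> x != y -> ~~ x -- y -> h x = h y.

Lemma apex_nadj x y : x != v -> y != v -> x != y -> ~~ x -- y -> h x = h y.
Proof.
move=> xv yv xy nxy; have [S [SF xS yS]] := tight_cover tF xy nxy.
case: (boolP (crossing [set v] B S)) => cS; first exact: hcross cS xS yS xv yv.
exact: hnoncross cS xS yS xv yv xy nxy.
Qed.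

End Coarser.

Lemma apex_cross0 S x y : S \in F -> excess [set v] B S = 0 ->
  x \in S -> y \in S -> x != v -> y != v -> apex_label x = apex_label y.
Proof.
move=> SF /(excess0 tF dvB nvB SF)[/crossv vS]; rewrite outN => S1 xS yS xv yv.
have /card_le1_eqP e : #|S :&: N| <= 1 by rewrite S1.
by apply: e; apply: apex_label_in.
Qed.

Lemma nbr_neq_apex x : x \in N -> x != v.
Proof. by rewrite inE; apply: contraTneq => ->; rewrite adj_irrefl. Qed.

(** Every member meets the neighbourhood of [v] exactly once, so labels are constant on members.
    Each class stays connected without [v], because [v] is a leaf attached to it at the label. *)
Lemma apex_perfect : (forall S, S \in F -> excess [set v] B S = 0) ->
  perfectly_connected G k.
Proof.
move=> e0; have hc S x y : S \in F -> crossing [set v] B S ->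
  x \in S -> y \in S -> x != v -> y != v -> apex_label x = apex_label y.
  by move=> SF _; apply: apex_cross0 (e0 S SF).
have hn S x y : S \in F -> ~~ crossing [set v] B S ->
  x \in S -> y \in S -> x != v -> y != v -> x != y -> ~~ x -- y ->
  apex_label x = apex_label y.
  by move=> SF _ xS yS xv yv _ _; apply: apex_cross0 (e0 S SF) xS yS xv yv.
have gN x : x != v -> apex_label x \in N by move=> /apex_labelP[]; rewrite inE.
have Ng l : l \in N -> exists2 x, x != v & apex_label x = l.
  by move=> lN; exists l; [apply: nbr_neq_apex | apply: apex_labelN; rewrite inE in lN].
have [lab [U [labI labN _ UE [pU mU]]]] := parts_of_labels cN gN Ng (apex_nadj hc hn).
have nbrE i : nbrs_in v (U i) = [set lab i].
  apply/setP => y; rewrite UE !inE; apply/andP/eqP => [[/andP[_ /eqP<-]]|->].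
    by move/apex_labelN.
  have := labN i => lN; have vl : v -- lab i by rewrite inE in lN.
  by rewrite vl apex_labelN // eqxx nbr_neq_apex.
exists v, U; split=> // i; last by rewrite nbrE cards1.
have [U0 vU _ _] := pU.
apply/connected_induced; split=> //.
have -> : U i = (v |: U i) :\ v by rewrite setU1K.
apply: (@linkedD1 _ _ _ (lab i)); rewrite ?setU11 //.
  by rewrite UE; apply: (apex_fibre_linked hc).
move=> y /setU1P[->|yU vy]; first by rewrite adj_irrefl.
by apply/set1P; rewrite -nbrE inE yU.
Qed.

(** Identifying [p] and [q] leaves [k - 1] classes, and the merged class is the one with two
    neighbours of [v]. The premises allow labels to differ only by confusing [p] with [q]. *)
Lemma apex_merge p q : 1 < k -> p \in N -> q \in N -> p != q ->
  (forall S x y, S \in F -> crossing [set v] B S ->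
     x \in S -> y \in S -> x != v -> y != v ->
     apex_label x = apex_label y \/ [set apex_label x; apex_label y] = [set p; q]) ->
  (forall S x y, S \in F -> ~~ crossing [set v] B S ->
     x \in S -> y \in S -> x != v -> y != v -> x != y -> ~~ x -- y ->
     apex_label x = apex_label y \/ [set apex_label x; apex_label y] = [set p; q]) ->
  exists (u : G) (U : 'I_(k - 1) -> {set G}),
    [/\ pointed_partition u U,
        forall i, connected (induced (u |: U i)),
        complete_multipartite U
      & exists t, #|nbrs_in u (U t)| = 2 /\
          forall i, i != t -> #|nbrs_in u (U i)| = 1].
Proof.
move=> k2 pN qN pq gc gn.
pose h x := if apex_label x == q then p else apex_label x.
have hE x y : apex_label x = apex_label y \/
    [set apex_label x; apex_label y] = [set p; q] -> h x = h y.
  rewrite /h => -[->//|e].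
  have : apex_label x \in [set p; q] /\ apex_label y \in [set p; q].
    by rewrite -e !inE !eqxx orbT.
  by case=> /set2P[]-> /set2P[]->; rewrite ?eqxx ?(negPf pq).
have hc S x y : S \in F -> crossing [set v] B S ->
  x \in S -> y \in S -> x != v -> y != v -> h x = h y.
  by move=> SF cS xS yS xv yv; apply: hE; apply: gc cS xS yS xv yv.
have hn S x y : S \in F -> ~~ crossing [set v] B S ->
  x \in S -> y \in S -> x != v -> y != v -> x != y -> ~~ x -- y -> h x = h y.
  by move=> SF cS xS yS xv yv xy nxy; apply: hE; apply: gn cS xS yS xv yv xy nxy.
have cNq : #|N :\ q| = k - 1 by rewrite -cN (cardsD1 q N) qN addKn.
have hN x : v -- x -> h x = if x == q then p else x by rewrite /h => /apex_labelN->.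
have hNq x : x != v -> h x \in N :\ q.
  move=> /apex_labelP[vg _]; rewrite /h; case: eqP => [_|/eqP gq].
    by rewrite !inE pq; rewrite inE in pN.
  by rewrite !inE gq.
have Nqh l : l \in N :\ q -> exists2 x, x != v & h x = l.
  move=> /setD1P[lq lN]; exists l; first exact: nbr_neq_apex.
  by rewrite hN ?(negPf lq) //; rewrite inE in lN.
have [lab [U [labI labN Nlab UE [pU mU]]]] := parts_of_labels cNq hNq Nqh (apex_nadj hc hn).
exists v, U; split=> //.
  move=> i; apply/connected_induced; split; last by rewrite UE; apply: (apex_fibre_linked hc).
  by apply/set0Pn; exists v; apply: setU11.
have [t lt] : exists i, lab i = p by apply: Nlab; rewrite !inE pq; rewrite inE in pN.
exists t; split=> [|i it].
  rewrite (_ : nbrs_in v (U t) = [set p; q]) ?cards2 ?pq //.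
  apply/setP => y; rewrite UE !inE lt; apply/andP/orP => [[/andP[_ hy] vy]|].
    by move: hy; rewrite hN //; case: (y =P q) => [_ _|_ ->]; [right|left].
  case=> /eqP->; [move: (pN)|move: (qN)]; rewrite inE => vy; split=> //.
    by rewrite (nbr_neq_apex pN) hN // (negPf pq) /=.
  by rewrite (nbr_neq_apex qN) hN // eqxx /=.
rewrite (_ : nbrs_in v (U i) = [set lab i]) ?cards1 //.
have lp : lab i != p by rewrite -lt (inj_eq labI).
have /setD1P[lq lN] := labN i.
apply/setP => y; rewrite UE !inE; apply/andP/eqP => [[/andP[_ /eqP hy] vy]|->].
  by move: hy; rewrite hN //; case: ifP => // _ e; rewrite -e eqxx in lp.
move: (lN); rewrite inE => vl; split=> //.
by rewrite (nbr_neq_apex lN) hN // (negPf lq) /=.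
Qed.

Lemma apex_B1 : 1 < k -> \sum_(S in F) excess [set v] B S <= 1 ->
  exists (u : G) (U : 'I_(k - 1) -> {set G}),
    [/\ pointed_partition u U,
        forall i, connected (induced (u |: U i)),
        complete_multipartite U
      & exists t, #|nbrs_in u (U t)| = 2 /\
          forall i, i != t -> #|nbrs_in u (U i)| = 1].
Proof.
move=> k2 s1.
have /card_gt1P[p0 [q0 [p0N q0N pq0]]] : 1 < #|N| by rewrite cN.
(* Without excess, any two neighbours of [v] may be merged. *)
have [/eqP s0|s0] := eqVneq (\sum_(S in F) excess [set v] B S) 0.
  have e0 S : S \in F -> excess [set v] B S = 0.
    by move=> SF; move: s0; rewrite sum_nat_eq0 => /forall_inP/(_ S SF)/eqP.
  apply: (apex_merge k2 p0N q0N pq0) => S x y SF _ xS yS xv yv.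
    by left; apply: apex_cross0 (e0 S SF) xS yS xv yv.
  by move=> _ _; left; apply: apex_cross0 (e0 S SF) xS yS xv yv.
have {}s1 : \sum_(S in F) excess [set v] B S = 1.
  by move: s0 s1; case: (\sum_(_ in _) _) => [|[]].
have [S0 [S0F eS0] eT] := sum_excess1 s1.
have caseS S x y : S \in F -> x \in S -> y \in S -> x != v -> y != v ->
    S = S0 \/ apex_label x = apex_label y.
  move=> SF xS yS xv yv; have [|SS] := eqVneq S S0; [by left|right].
  exact: apex_cross0 (eT S SF SS) xS yS xv yv.
(* A crossing exceptional member carries only its two labels [p] and [q]. A noncrossing triple has
   at most one nonadjacent pair, whose labels are merged if they differ. *)
case: (excess1 tF dvB nvB S0F eS0) => [[cS]|[ncS S3]].
  rewrite outN => /eqP/cards2P[p [q [pq SNE]]].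
  have [pN qN] : p \in N /\ q \in N.
    have [] : p \in S0 :&: N /\ q \in S0 :&: N by rewrite SNE !inE !eqxx orbT.
    by move=> /setIP[_ ?] /setIP[_ ?].
  apply: (apex_merge k2 pN qN pq) => S x y SF cT xS yS xv yv; last first.
    move=> _ _; case: (caseS S x y SF xS yS xv yv) => [SS|]; last by left.
    by rewrite SS cS in cT.
  case: (caseS S x y SF xS yS xv yv) => [SS|]; last by left.
  rewrite SS in xS yS; have [|gxy] := eqVneq (apex_label x) (apex_label y); first by left.
  right; apply/eqP; rewrite eqEcard -SNE subUset !sub1set.
  by rewrite !(apex_label_in S0F (crossv cS)) // SNE !cards2 gxy pq.
case: (boolP [exists x in S0, exists y in S0,
  [&& x != v, y != v, x != y, ~~ x -- y & apex_label x != apex_label y]]).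
  case/exists_inP => a aS /exists_inP[b bS /and5P[av bv ab nab gab]].
  have [va _] := apex_labelP av; have [vb _] := apex_labelP bv.
  apply: (apex_merge k2 _ _ gab); rewrite ?inE //.
    move=> S x y SF cT xS yS xv yv.
    case: (caseS S x y SF xS yS xv yv) => [SS|]; last by left.
    by rewrite SS (negPf ncS) in cT.
  move=> S x y SF cT xS yS xv yv xy nxy.
  case: (caseS S x y SF xS yS xv yv) => [SS|]; last by left.
  rewrite SS in xS yS; right.
  have := linked3_nadj (tight_linked tF S0F) S3 xS yS xy nxy aS bS ab nab.
  by move=> /(congr1 (fun X : {set G} => apex_label @: X)); rewrite !imsetU1 !imset_set1.
move/exists_inPn => none; apply: (apex_merge k2 p0N q0N pq0) => S x y SF cT xS yS xv yv.
  case: (caseS S x y SF xS yS xv yv) => [SS|]; last by left.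
  by rewrite SS (negPf ncS) in cT.
move=> xy nxy; case: (caseS S x y SF xS yS xv yv) => [SS|]; last by left.
rewrite SS in xS yS; left; apply/eqP; apply: contraT => gxy.
have := none x xS => /exists_inPn/(_ y yS).
by rewrite xv yv xy nxy gxy.
Qed.

End Apex.
End Labels.

(** * Minimum cuts and the classes of graphs *)

Section Connectivity.
Variable G : sgraph.
Implicit Types (x y z v : G) (S A B : {set G}).

Lemma k_connected_linked k S :
  k_connected k G -> #|S| < k -> ~: S != set0 /\ linked (~: S).
Proof. by case=> _ h Sk; apply/connected_induced; apply: h. Qed.

(** Deleting fewer than [k] neighbours would isolate [v] from the remaining vertices. *)
Lemma min_degree k v : k_connected k G -> k <= #|[set y | v -- y]|.
Proof.
move=> kG; rewrite leqNgt; apply/negP => Nk.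
have [_ lN] := k_connected_linked kG Nk; have [kn _] := kG.
set N := [set y | v -- y] in Nk lN.
have [w wN] : exists w, w \notin v |: N.
  apply/existsP; apply: contraT => /existsPn h.
  have : #|v |: N| < #|G|.
    by rewrite cardsU1; apply: leq_ltn_trans kn; case: (_ \notin _) => //; apply: ltnW.
  rewrite (_ : v |: N = setT) ?cardsT ?ltnn //.
  by apply/setP => w; have := h w; rewrite negbK !inE.
move: wN; rewrite in_setU1 negb_or => /andP[wv wN].
have vN : v \in ~: N by rewrite !inE adj_irrefl.
have wN' : w \in ~: N by rewrite in_setC.
have wv1 : w \notin [set v] by rewrite inE.
have [u [t [_ /set1P-> + _ vt]]] := linked_split lN vN (set11 v) wN' wv1.
by rewrite !inE vt.
Qed.

Lemma card_le_edges k : 2 <= k -> k_connected k G -> #|G| <= #|edges G|.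
Proof.
move=> k2 kG; pose D := [set p : G * G | p.1 -- p.2].
have D1 : #|D| = \sum_(x : G) #|[set y | x -- y]|.
  rewrite -sum1_card (eq_bigl (fun p : G * G => xpredT p.1 && (p.1 -- p.2))).
    rewrite -(pair_big_dep xpredT (fun x y => x -- y) (fun _ _ => 1)) /=.
    by apply: eq_bigr => x _; rewrite sum1dep_card.
  by move=> p; rewrite inE.
have D2 : #|D| <= #|edges G| * 2.
  (* An oriented edge is encoded by the edge and a bit comparing the ranks of its ends. *)
  pose f (p : G * G) := ([set p.1; p.2], enum_rank p.1 < enum_rank p.2).
  have fI : {in D &, injective f}.
    move=> [x y] [z t]; rewrite !inE /= => xy zt [e1 e2].
    have : x \in [set z; t] /\ y \in [set z; t] by rewrite -e1 !inE !eqxx orbT.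
    case=> /set2P[]ex /set2P[]ey; rewrite ex ey // in xy e2 *.
    - by rewrite adj_irrefl in xy.
    - have tz : t != z by apply: contraTneq xy => ->; rewrite adj_irrefl.
      move: e2 tz; rewrite -(inj_eq enum_rank_inj) -val_eqE /=.
      by case: ltngtP.
    - by rewrite adj_irrefl in xy.
  rewrite -(card_in_imset fI) -card_bool -cardsT -cardsX; apply: subset_leq_card.
  apply/subsetP => _ /imsetP[[x y] xy ->]; rewrite !inE andbT /= edgesP //.
  by rewrite inE in xy.
have : #|G| * 2 <= #|D|.
  rewrite D1 -[#|G|]sum1_card big_distrl /=; apply: leq_sum => x _.
  by rewrite mul1n; apply: leq_trans k2 (min_degree x kG).
by move=> h; have := leq_trans h D2; rewrite leq_pmul2r.
Qed.

(** [k_connected] is a proposition; a boolean search over vertex sets decides it constructively and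
    exhibits a separating set on failure. *)
Lemma k_connectedP k : k_connected k G \/
  #|G| <= k \/ exists S, #|S| < k /\ ~ (~: S != set0 /\ linked (~: S)).
Proof.
case: (leqP #|G| k) => [|kn]; first by right; left.
case: (boolP [exists S : {set G}, (#|S| < k) && ~~ ((~: S != set0) && linked (~: S))]).
  case/existsP => S /andP[Sk h]; right; right; exists S; split=> // -[h1 h2].
  by rewrite h1 h2 in h.
move=> /existsPn h; left; split=> // S Sk; apply/connected_induced.
by have := h S; rewrite Sk /= negbK => /andP.
Qed.

(** When a side of the cut is a single vertex, its neighbours lie in the cut, so its degree is
    exactly [k]. The same alternative absorbs the case of [k + 1] vertices, where there may be no
    cut. *)
Lemma min_cut k : k_connected k G -> ~ k_connected k.+1 G ->
  (exists v, #|[set y | v -- y]| = k) \/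
  exists A B, [/\ [disjoint A & B], {in A & B, forall x y, ~~ x -- y},
    1 < #|A|, 1 < #|B| & #|~: (A :|: B)| = k].
Proof.
move=> kG nkG; have [kn _] := kG.
have degk v : #|[set y | v -- y]| <= k -> #|[set y | v -- y]| = k.
  by move=> h; apply/eqP; rewrite eqn_leq h min_degree.
have [//|[nk|[S [Sk nS]]]] := k_connectedP k.+1.
  have /card_gt0P[v _] : 0 < #|G| by apply: leq_trans kn.
  left; exists v; apply: degk; rewrite -ltnS; apply: leq_trans nk.
  rewrite -cardsT; apply: proper_card; apply/properP; split; first exact: subsetT.
  by exists v; rewrite ?inE ?adj_irrefl.
have S0 : ~: S != set0.
  rewrite -card_gt0; have := cardsC S; move: Sk kn; rewrite ltnS.
  by card_lia.
have cS : #|S| = k.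
  apply/eqP; rewrite eqn_leq -ltnS Sk /= leqNgt; apply/negP => Sk'.
  by apply: nS; apply: k_connected_linked Sk'.
have [x [y [xS yS nxy]]] : exists x y, [/\ x \in ~: S, y \in ~: S &
    ~~ connect (adjin (~: S)) x y].
  case: (boolP (linked (~: S))) => [lS|]; first by case: nS.
  by case/forall_inPn => x xS /forall_inPn[y yS nxy]; exists x, y.
pose A := [set z in ~: S | connect (adjin (~: S)) x z].
pose B := ~: S :\: A.
have AS : A \subset ~: S by apply/subsetP => z; rewrite inE => /andP[].
have ABS : A :|: B = ~: S.
  by rewrite -[RHS](setID _ A) (setIidPr AS).
have dAB : [disjoint A & B].
  by rewrite -setI_eq0 /B setDE setICA setICr setI0.
have nAB : {in A & B, forall u w, ~~ u -- w}.
  move=> u w uA /setDP[wS wA]; apply: contra wA => uw; rewrite inE wS /=.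
  move: uA; rewrite inE => /andP[uS xu]; apply: connect_trans xu (connect1 _).
  by rewrite /adjin uS wS.
have xA : x \in A by rewrite inE xS connect0.
have yB : y \in B by apply/setDP; split=> //; rewrite inE negb_and nxy orbT.
have single z X Y : X :|: Y = ~: S -> {in X & Y, forall u w, ~~ u -- w} ->
    z \in X -> #|X| <= 1 -> exists v, #|[set y | v -- y]| = k.
  move=> XYS nXY zX X1; exists z; apply: degk; rewrite -cS; apply: subset_leq_card.
  apply/subsetP => w; rewrite inE => zw; apply: contraT => wS.
  have : w \in X :|: Y by rewrite XYS inE.
  case/setUP => [wX|wY]; last by rewrite (negPf (nXY z w zX wY)) in zw.
  by rewrite (card_le1_eqP X1 z w zX wX) adj_irrefl in zw.
have [A1|A2] := leqP #|A| 1; first by left; apply: single ABS nAB xA A1.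
have [B1|B2] := leqP #|B| 1.
  left; apply: (single y B A) => //; first by rewrite setUC.
  by move=> u w uB wA; rewrite adj_sym nAB.
by right; exists A, B; rewrite ABS setCK.
Qed.

End Connectivity.

Lemma iso_sym (F H : sgraph) : iso F H -> iso H F.
Proof.
case=> f [g fK gK] fE; exists g; first by exists f.
by move=> x y; rewrite -fE !gK.
Qed.

Lemma iso_trans (F H K : sgraph) : iso F H -> iso H K -> iso F K.
Proof.
case=> f fB fE [g gB gE]; exists (g \o f); first exact: bij_comp.
by move=> x y /=; rewrite gE fE.
Qed.

Lemma iso_join_l (F F' H : sgraph) : iso F F' -> iso (join F H) (join F' H).
Proof.
case=> f [g fK gK] fE.
exists (fun z : join F H => match z with inl x => inl (f x) | inr y => inr y end
  : join F' H).
  exists (fun z : join F' H => match z with inl x => inl (g x) | inr y => inr y end).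
    by case=> x //=; rewrite fK.
  by case=> x //=; rewrite gK.
by case=> x [] y //=.
Qed.

(** * Recognising the classes from a set that contains both sides of a cut *)

Section Builders.
Variables (G : sgraph) (A B W : {set G}).
Hypothesis dAB : [disjoint A & B].
Hypothesis nAB : {in A & B, forall x y, ~~ x -- y}.
Hypothesis A0 : A != set0.
Hypothesis B0 : B != set0.
Hypothesis ABW : A :|: B \subset W.
Implicit Types (x y z v : G) (S : {set G}).

Lemma induced_complete p S : #|S| = p ->
  {in S &, forall x y, x != y -> x -- y} -> is_complete p (induced S).
Proof.
move=> cS aS; have c : #|induced S| = p by rewrite card_induced.
exists (fun x : induced S => cast_ord c (enum_rank x)).
  exists (fun i => enum_val (cast_ord (esym c) i)) => x.
    by rewrite cast_ordK enum_rankK.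
  by rewrite enum_valK cast_ordKV.
move=> x y; rewrite /= /complete_adj (inj_eq (inj_comp (@cast_ord_inj _ _ c) enum_rank_inj)).
rewrite /induced_adj; have [->|xy] := eqVneq x y; first by rewrite adj_irrefl.
by rewrite aS ?(valP x) ?(valP y) // (inj_eq val_inj).
Qed.

Lemma induced_complete_minus p S x y : #|S| = p -> x \in S -> y \in S ->
  x != y -> ~~ x -- y ->
  {in S &, forall z t, z != t -> ~~ z -- t -> [set z; t] = [set x; y]} ->
  is_complete_minus p (induced S).
Proof.
move=> cS xS yS xy nxy uS; have c : #|induced S| = p by rewrite card_induced.
pose f (z : induced S) := cast_ord c (enum_rank z).
have fB : bijective f.
  exists (fun i => enum_val (cast_ord (esym c) i)) => z.
    by rewrite /f cast_ordK enum_rankK.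
  by rewrite /f enum_valK cast_ordKV.
have fI := bij_inj fB.
pose x' : induced S := Sub x xS; pose y' : induced S := Sub y yS.
exists (f x', f y'); first by rewrite /= /complete_adj (inj_eq fI).
exists f => // z t; rewrite /= /del_edge_adj /= /complete_adj (inj_eq fI) /induced_adj.
have -> : [set f z; f t] = f @: [set z; t] by rewrite imsetU1 imset_set1.
have -> : [set f x'; f y'] = f @: [set x'; y'] by rewrite imsetU1 imset_set1.
rewrite (inj_eq (imset_inj fI)) -(inj_eq (imset_inj val_inj)) !imsetU1 !imset_set1 /=.
have [->|zt] := eqVneq z t; first by rewrite adj_irrefl.
have vzt : val z != val t by rewrite (inj_eq val_inj).
rewrite /=; case: (boolP (val z -- val t)) => azt.
  apply/negP => /eqP e; have : val z \in [set x; y] /\ val t \in [set x; y].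
    by rewrite -e !inE !eqxx orbT.
  case=> /set2P[]ez /set2P[]et; move: azt vzt; rewrite ez et ?eqxx ?(negPf nxy) //.
  by rewrite adj_sym (negPf nxy).
by apply/negbTE; rewrite negbK; apply/eqP; apply: uS; rewrite ?(valP z) ?(valP t).
Qed.

Lemma join_partitionC : ~: W != set0 ->
  (forall x y, x != y -> ~~ x -- y -> x \notin W -> y \notin W) ->
  join_partition (~: W) W.
Proof.
move=> W0 h; split=> //.
- have [x xA] := set0Pn _ A0; apply/set0Pn; exists x.
  by apply: (subsetP ABW); rewrite inE xA.
- by rewrite -setI_eq0 setIC setICr.
- by rewrite setUC setUCr.
move=> x y; rewrite inE => xW yW; apply: contraT => nxy.
have := h x y _ nxy xW; rewrite yW; apply.
by apply: contraNneq xW => ->.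
Qed.

Lemma not_linkedAB : ~~ linked (A :|: B).
Proof.
apply/negP => lAB.
have [x xA] := set0Pn _ A0; have [y yB] := set0Pn _ B0.
have xAB : x \in A :|: B by rewrite inE xA.
have yAB : y \in A :|: B by rewrite inE yB orbT.
have yA : y \notin A by rewrite (disjointFl dAB yB).
have [u [w [_ uA /setUP[->//|wB] wA uw]]] := linked_split lAB xAB xA yAB yA.
by rewrite (negPf (nAB uA wB)) in uw.
Qed.

(** Deleting [X] from the graph on [W] amounts to deleting [X] and the [k - 2] vertices outside [W]
    from [G], whence 2-connectedness. The two vertices of [W] outside [A :|: B] separate [A] from
    [B]. *)
Lemma B2_structure k : 3 <= k -> k_connected k G -> #|~: W| = k - 2 ->
  #|W :\: (A :|: B)| = 2 ->
  (forall x y, x != y -> ~~ x -- y -> x \in W) ->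
  exists U W0 : {set G},
    [/\ join_partition U W0, is_complete (k - 2) (induced U),
        k_connected 2 (induced W0) & ~ k_connected 3 (induced W0)].
Proof.
move=> k3 kG cU cW nW; exists (~: W), W; split.
- apply: join_partitionC; first by rewrite -card_gt0 cU; lia.
  by move=> x y xy nxy; rewrite (nW x y).
- apply: induced_complete => // x y; rewrite !inE => xW yW xy.
  by apply: contraNT xW => nxy; apply: nW xy nxy.
- have [kn _] := kG; split=> [|X X2].
    by rewrite card_induced; have := cardsC W; move: kn cU k3; card_lia.
  have imX : val @: (~: X) = ~: (~: W :|: val @: X).
    apply/setP => x; rewrite !inE negb_or negbK.
    apply/imsetP/andP => [[y yX ->]|[xW xX]].
      rewrite (valP y); split=> //; apply: contraNN (_ : y \notin X).
        by case/imsetP => z zX /val_inj->.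
      by rewrite inE in yX.
    exists (Sub x xW) => //; rewrite inE; apply: contraNN xX => xX.
    by apply/imsetP; exists (Sub x xW).
  have sm : #|~: W :|: val @: X| < k.
    apply: leq_ltn_trans (leq_card_setU _ _) _; rewrite cU card_imset; last exact: val_inj.
    by move: X2 k3; card_lia.
  have [ne li] := k_connected_linked kG sm.
  apply/connected_induced; split; last by rewrite -linked_val imX.
  by apply: contraNneq ne => X0; rewrite -imX X0 imset0.
case=> _ h; pose X : {set induced W} := [set z | val z \notin A :|: B].
have imX : val @: X = W :\: (A :|: B).
  apply/setP => x; apply/imsetP/setDP => [[z + ->]|[xW xAB]].
    by rewrite inE (valP z).
  by exists (Sub x xW); rewrite // inE.
have imCX : val @: (~: X) = A :|: B.
  apply/setP => x; apply/imsetP/idP => [[z + ->]|xAB].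
    by rewrite !inE negbK.
  by exists (Sub x (subsetP ABW x xAB)); rewrite // !inE negbK -in_setU.
have X2 : #|X| < 3 by rewrite -(card_imset _ val_inj) imX cW.
have /connected_induced[_] := h X X2.
by rewrite -linked_val imCX (negPf not_linkedAB).
Qed.

(** Walks in [W] that avoid [s] stay in [A :|: B] and cannot pass from [A] to [B]. *)
Lemma cut_vertex_induced s : linked W -> W :\: (A :|: B) = [set s] ->
  has_cut_vertex (induced W).
Proof.
move=> lW Ws; have /setDP[sW sAB] : s \in W :\: (A :|: B) by rewrite Ws set11.
have [x xA] := set0Pn _ A0; have [y yB] := set0Pn _ B0.
have xAB : x \in A :|: B by rewrite inE xA.
have yAB : y \in A :|: B by rewrite inE yB orbT.
have [_ cW] : connected (induced W).
  by apply/connected_induced; split=> //; apply/set0Pn; exists s.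
pose s' : induced W := Sub s sW; exists s'.
have inC z (zW : z \in W) : z \in A :|: B -> (Sub z zW : induced W) \in [set~ s'].
  by move=> zAB; rewrite !inE -val_eqE /=; apply: contraNneq sAB => <-.
pose emb z (zAB : z \in A :|: B) : induced [set~ s'] :=
  Sub (Sub z (subsetP ABW z zAB)) (inC z (subsetP ABW z zAB) zAB).
exists (emb x xAB), (emb y yAB); split; first exact: cW.
have cl (a b : induced [set~ s']) : connect (@adj _) a b ->
    val (val a) \in A -> val (val b) \in A.
  case/connectP => p; elim: p a => [|c p IH] a /=; first by move=> _ ->.
  case/andP => ac pc eb aA; apply: (IH c pc eb).
  have cs : val (val c) != s.
    by have := valP c; rewrite !inE -val_eqE.
  have cAB : val (val c) \in A :|: B.
    apply: contraNT cs => cAB; apply/eqP/set1P.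
    by rewrite -Ws inE cAB (valP (val c)).
  case/setUP: cAB => // cB.
  by have := nAB aA cB; rewrite (ac : val (val a) -- val (val c)).
by move=> /cl/(_ xA); rewrite /= (disjointFl dAB yB).
Qed.

Lemma B3_structure k s x y : linked W -> W :\: (A :|: B) = [set s] ->
  #|~: W| = k - 1 -> x \notin W -> y \notin W -> x != y -> ~~ x -- y ->
  (forall z t, z != t -> ~~ z -- t ->
     (z \in W /\ t \in W) \/ [set z; t] = [set x; y]) ->
  exists U W0 : {set G},
    [/\ join_partition U W0, is_complete_minus (k - 1) (induced U),
        connected (induced W0) & has_cut_vertex (induced W0)].
Proof.
move=> lW Ws cU xW yW xy nxy h; exists (~: W), W; split.
- apply: join_partitionC; first by apply/set0Pn; exists x; rewrite inE.
  move=> z t zt nzt zW; case: (h z t zt nzt) => [[zW']|e]; first by rewrite zW' in zW.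
  have : t \in [set x; y] by rewrite -e !inE eqxx orbT.
  by case/set2P => ->.
- apply: (@induced_complete_minus _ _ x y); rewrite ?inE // => z t; rewrite !inE => zW tW zt nzt.
  by case: (h z t zt nzt) => // -[zW']; rewrite zW' in zW.
- apply/connected_induced; split=> //; apply/set0Pn; exists s.
  by have /setDP[] : s \in W :\: (A :|: B) by rewrite Ws set11.
exact: cut_vertex_induced Ws.
Qed.

Lemma class_A_structure k n s : linked W -> W :\: (A :|: B) = [set s] ->
  1 < k -> #|~: W| = k - 1 -> #|W| = n - k + 1 ->
  (forall z t, z != t -> ~~ z -- t -> z \in W) ->
  class_A G n k.
Proof.
move=> lW Ws k1 cU cW h; exists (induced W); split.
- apply/connected_induced; split=> //; apply/set0Pn; exists s.
  by have /setDP[] : s \in W :\: (A :|: B) by rewrite Ws set11.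
- by rewrite card_induced.
- exact: cut_vertex_induced Ws.
have jW : join_partition (~: W) W.
  apply: join_partitionC; first by rewrite -card_gt0 cU subn_gt0.
  by move=> z t zt nzt; rewrite (h z t).
apply: iso_trans (iso_sym (join_partition_iso jW)) _.
apply: iso_join_l; apply: induced_complete => // x y; rewrite !inE => xW yW xy.
by apply: contraNT xW => nxy; apply: h xy nxy.
Qed.

End Builders.

(** * Covers of extremal and near-extremal weight *)

Lemma total_span_cut_ge (G : sgraph) (F : {set {set G}}) (A B : {set G}) :
  tight F -> [disjoint A & B] -> {in A & B, forall x y, ~~ x -- y} ->
  A != set0 -> B != set0 ->
  #|A| + #|B| - 1 <= total_span F A B.
Proof.
move=> tF dAB nAB; apply: total_span_ge => x y xA yB.
apply: (tight_cover tF); last exact: nAB.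
by apply/eqP => xy; rewrite -xy (disjointFr dAB xA) in yB.
Qed.

(** * Cuts with at least two vertices on each side *)

Section TwoSided.
Variables (G : sgraph) (k : nat) (F : {set {set G}}) (A B : {set G}).
Hypothesis tF : tight F.
Hypothesis k3 : 3 <= k.
Hypothesis kG : k_connected k G.
Hypothesis dAB : [disjoint A & B].
Hypothesis nAB : {in A & B, forall x y, ~~ x -- y}.
Hypothesis A2 : 1 < #|A|.
Hypothesis B2 : 1 < #|B|.
Hypothesis cutk : #|~: (A :|: B)| = k.
Implicit Types (x y z : G) (S T : {set G}).

Let A0 : A != set0. Proof. by rewrite -card_gt0 ltnW. Qed.
Let B0 : B != set0. Proof. by rewrite -card_gt0 ltnW. Qed.

Let cAB : #|A :|: B| = #|A| + #|B|.
Proof. by rewrite cardsU disjoint_setI0 // cards0 subn0. Qed.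

Lemma two_sided_card : #|G| = #|A| + #|B| + k.
Proof. by rewrite -(cardsC (A :|: B)) cAB cutk. Qed.

Let coversAB : covers F A B.
Proof.
move=> x y xA yB; apply: (tight_cover tF); last exact: nAB.
by apply/eqP => xy; rewrite -xy (disjointFr dAB xA) in yB.
Qed.

Lemma two_sided_main : total_span F A B <= #|A| + #|B| - 1 ->
  exists S0, [/\ S0 \in F, A :|: B \subset S0 &
    forall S, S \in F -> crossing A B S -> S = S0].
Proof.
move=> mF; have [x xA] := set0Pn _ A0; have [y yB] := set0Pn _ B0.
have [S0 [SF xS yS]] := coversAB xA yB.
have sub S : S \in F -> crossing A B S -> A :|: B \subset S.
  exact: total_span_min (tight_linear tF) coversAB A2 B2 mF.
have ABS := sub S0 SF (crossing_mem xA xS yB yS).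
exists S0; split=> // S SF' cS; have [x' [y' [x'A y'A xy]]] := card_gt1P A2.
have inAB z S' : A :|: B \subset S' -> z \in A -> z \in S'.
  by move=> /subsetP s zA; apply: s; rewrite inE zA.
by apply: (tight_eq tF SF' SF xy); apply: inAB => //; apply: sub.
Qed.

Let cardW S : A :|: B \subset S -> #|S| = #|A| + #|B| + #|S :\: (A :|: B)|.
Proof. by move=> /setIidPr sAB; rewrite -(cardsID (A :|: B) S) sAB cAB. Qed.

Let cardCW S : A :|: B \subset S -> #|~: S| = k - #|S :\: (A :|: B)|.
Proof.
move=> sAB; have := cardsC S; have := cardW sAB; have := two_sided_card.
card_lia.
Qed.

(** Neither the span nor the excess has slack: every member crosses, hence equals [S0], which
    contains all nonadjacent pairs and a single cut vertex. *)
Lemma two_sided_A n : #|G| = n -> weight F < #|A| + #|B| -> class_A G n k.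
Proof.
move=> Gn; rewrite (weight_excess tF dAB nAB) => wF.
have ge := total_span_cut_ge tF dAB nAB A0 B0.
have [mF /eqP] : total_span F A B <= #|A| + #|B| - 1 /\
    \sum_(S in F) excess A B S = 0.
  move: wF ge; move: (total_span _ _ _) (\sum_(_ in _) _) => t e.
  by have := ltnW A2; card_lia.
rewrite sum_nat_eq0 => /forall_inP e0.
have e0' S : S \in F -> crossing A B S /\ #|S :\: (A :|: B)| = 1.
  by move=> SF; apply: (excess0 tF dAB nAB SF); apply/eqP; apply: e0.
have [S0 [SF sAB uS]] := two_sided_main mF.
have [_ S1] := e0' S0 SF; have /cards1P[s Ss] : #|S0 :\: (A :|: B)| == 1 by rewrite S1.
apply: (class_A_structure dAB nAB A0 B0 sAB (tight_linked tF SF) Ss).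
- by apply: leq_trans k3.
- by rewrite cardCW // S1.
- by rewrite cardW // S1 -Gn two_sided_card addnK.
move=> z t zt nzt; have [S [SF' zS _]] := tight_cover tF zt nzt.
by rewrite -(uS S SF' (e0' S SF').1).
Qed.

(** The slack is one exceptional member [T]. If [T] crosses, it is the member containing [A :|: B],
    now with two cut vertices, and the second class results. If [T] is a triple, its nonadjacent
    pair is the missing edge of the third class, unless adding one vertex to [S0] absorbs the pair
    and gives the second class again. *)
Lemma two_sided_B : weight F = #|A| + #|B| ->
  (exists U W : {set G},
    [/\ join_partition U W, is_complete (k - 2) (induced U),
        k_connected 2 (induced W) & ~ k_connected 3 (induced W)]) \/
  (exists U W : {set G},
    [/\ join_partition U W, is_complete_minus (k - 1) (induced U),
        connected (induced W) & has_cut_vertex (induced W)]).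
Proof.
rewrite (weight_excess tF dAB nAB) => wF.
have ge := total_span_cut_ge tF dAB nAB A0 B0.
have [[totE s0]|[mF s1]] : (total_span F A B = #|A| + #|B| /\
    \sum_(S in F) excess A B S = 0) \/
    (total_span F A B <= #|A| + #|B| - 1 /\ \sum_(S in F) excess A B S = 1).
  move: wF ge; move: (total_span _ _ _) (\sum_(_ in _) _) => t e.
  by have := ltnW A2; card_lia.
  (* Zero excess makes every member cross with one cut vertex, so slack in the span is
     impossible. *)
  have := total_span_neq tF dAB nAB A2 B2; rewrite totE eqxx => h.
  have // : false; apply: h => S SF.
  have [|cS S1] := excess0 tF dAB nAB SF.
    by apply/eqP; move/eqP: s0; rewrite sum_nat_eq0 => /forall_inP/(_ S SF).
  by rewrite (card_split dAB) S1.
have [S0 [SF0 sAB uS]] := two_sided_main mF.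
have mkB2 (W : {set G}) : A :|: B \subset W -> #|W :\: (A :|: B)| = 2 ->
    (forall x y, x != y -> ~~ x -- y -> x \in W) ->
    exists U W0 : {set G},
    [/\ join_partition U W0, is_complete (k - 2) (induced U),
        k_connected 2 (induced W0) & ~ k_connected 3 (induced W0)].
  move=> sW W2; apply: (B2_structure dAB nAB A0 B0 sW k3 kG) => //.
  by rewrite cardCW // W2.
have [T [TF eT] e0] := sum_excess1 s1.
have e0' S : S \in F -> S != T -> S = S0 /\ #|S :\: (A :|: B)| = 1.
  move=> SF ST; have [cS S1] := excess0 tF dAB nAB SF (e0 S SF ST).
  by rewrite {1}(uS S SF cS).
case: (excess1 tF dAB nAB TF eT) => [[cT T2]|[ncT T3]].
  have TS := uS T TF cT; rewrite TS in T2.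
  left; apply: (mkB2 S0 sAB T2) => x y xy nxy.
  have [S [SF xS _]] := tight_cover tF xy nxy.
  by have [ST|/(e0' S SF)[<-//]] := eqVneq S T; rewrite -TS -ST.
have ST : S0 != T.
  apply: contraNneq ncT => <-; have [x xA] := set0Pn _ A0; have [y yB] := set0Pn _ B0.
  apply: (crossing_mem xA _ yB); apply: (subsetP sAB); rewrite inE ?xA //.
  by rewrite yB orbT.
have [_ S1] := e0' S0 SF0 ST.
have nadj x y : x != y -> ~~ x -- y -> (x \in S0 /\ y \in S0) \/ (x \in T /\ y \in T).
  move=> xy nxy; have [S [SF xS yS]] := tight_cover tF xy nxy.
  have [SeT|/(e0' S SF)[SS _]] := eqVneq S T; first by right; rewrite -SeT.
  by left; rewrite -SS.
have grow z : z \notin S0 ->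
    (forall x y, x != y -> ~~ x -- y -> x \in z |: S0) ->
    exists U W0 : {set G},
    [/\ join_partition U W0, is_complete (k - 2) (induced U),
        k_connected 2 (induced W0) & ~ k_connected 3 (induced W0)].
  move=> zS; apply: mkB2; first exact: subset_trans sAB (subsetUr _ _).
  rewrite (_ : _ :\: _ = z |: (S0 :\: (A :|: B))).
    by rewrite cardsU1 S1 inE (negPf zS) andbF.
  apply/setP => x; rewrite !in_setD !in_setU1 in_setD; case: (x =P z) => //= ->.
  by rewrite andbT; apply: contra zS; apply: (subsetP sAB).
case: (boolP [exists x in T, exists y in T, (x != y) && ~~ x -- y]); last first.
  move/exists_inPn => none; left.
  (* All nonadjacent pairs already lie in [S0]; any outside vertex brings its number of cut vertices
     to two. *)
  have /card_gt0P[z] : 0 < #|~: S0| by rewrite cardCW // S1 subn_gt0; apply: leq_trans k3.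
  rewrite inE => zS; apply: (grow z zS) => x y xy nxy.
  case: (nadj x y xy nxy) => [[xS _]|[xT yT]]; first exact: setU1r.
  by have := none x xT => /exists_inPn/(_ y yT); rewrite xy nxy.
case/exists_inP => x xT /exists_inP[y yT /andP[xy nxy]].
have uT z t : z != t -> ~~ z -- t -> (z \in S0 /\ t \in S0) \/ [set z; t] = [set x; y].
  move=> zt nzt; case: (nadj z t zt nzt) => [|[zT tT]]; [by left|right].
  exact: (linked3_nadj (tight_linked tF TF) T3).
have mk z t : z \in S0 -> [set z; t] = [set x; y] -> t \notin S0 ->
    exists U W0 : {set G},
    [/\ join_partition U W0, is_complete (k - 2) (induced U),
        k_connected 2 (induced W0) & ~ k_connected 3 (induced W0)].
  move=> zS e tS; apply: (grow t tS) => u w uw nuw.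
  case: (uT u w uw nuw) => [[uS0 _]|e']; first exact: setU1r.
  have : u \in [set z; t] by rewrite e -e' !inE eqxx.
  by case/set2P => ->; [apply: setU1r | apply: setU11].
have notboth : ~ (x \in S0 /\ y \in S0).
  by case=> xS yS; move/eqP: ST; apply; apply: (tight_eq tF SF0 TF xy).
have [xS|xS] := boolP (x \in S0).
  by left; apply: (mk x y) => //; apply/negP => yS; apply: notboth.
have [yS|yS] := boolP (y \in S0).
  by left; apply: (mk y x) => //; rewrite setUC.
right; have /cards1P[s Ss] : #|S0 :\: (A :|: B)| == 1 by rewrite S1.
apply: (B3_structure dAB nAB A0 B0 sAB (tight_linked tF SF0) Ss _ xS yS) => //.
by rewrite cardCW // S1.
Qed.

End TwoSided.

(** * Cuts around a vertex of degree k, and the resulting weights *)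

Lemma apex_cut (G : sgraph) (v : G) (k : nat) : #|[set y | v -- y]| = k ->
  let B := ~: (v |: [set y | v -- y]) in
  [/\ [disjoint [set v] & B], {in [set v] & B, forall x y, ~~ x -- y}
    & #|B| + k.+1 = #|G|].
Proof.
move=> cN /=; split.
- by rewrite disjoints1 !inE eqxx.
- by move=> x y /set1P->; rewrite !inE negb_or => /andP[].
have := cardsC (v |: [set y | v -- y]).
by rewrite cardsU1 inE adj_irrefl cN /= add1n addnC.
Qed.

Lemma apex_total_span (G : sgraph) (v : G) (k : nat) (F : {set {set G}}) :
  tight F -> #|[set y | v -- y]| = k ->
  let B := ~: (v |: [set y | v -- y]) in #|B| <= total_span F [set v] B.
Proof.
move=> tF cN /=; have [dAB nAB _] := apex_cut cN; set B := ~: _ in dAB nAB *.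
(* [B] is empty when [v] is adjacent to all other vertices; the bound is then trivial. *)
have [->|B0] := eqVneq B set0; first by rewrite cards0.
have := total_span_cut_ge tF dAB nAB _ B0; rewrite cards1 add1n subn1; apply.
by apply/set0Pn; exists v; apply: set11.
Qed.

Lemma weight_lower_bound (G : sgraph) (k : nat) (F : {set {set G}}) :
  tight F -> k_connected k G -> ~ k_connected k.+1 G ->
  #|G| <= weight F + k.+1.
Proof.
move=> tF kG nkG; case: (min_cut kG nkG) => [[v cN]|[A [B [dAB nAB A2 B2 cutk]]]].
  have [dAB nAB <-] := apex_cut cN; rewrite leq_add2r (weight_excess tF dAB nAB).
  by apply: leq_trans (leq_addr _ _); apply: apex_total_span tF cN.
rewrite (two_sided_card dAB cutk) (weight_excess tF dAB nAB).
have := total_span_cut_ge tF dAB nAB; rewrite -!card_gt0 => /(_ (ltnW A2) (ltnW B2)).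
by move: (total_span _ _ _) (\sum_(_ in _) _) => t e; card_lia.
Qed.

Lemma weight_extremal (G : sgraph) (k n : nat) (F : {set {set G}}) :
  3 <= k -> tight F -> k_connected k G -> ~ k_connected k.+1 G -> #|G| = n ->
  (weight F + k.+1 = n <-> perfectly_connected G k \/ class_A G n k).
Proof.
move=> k3 tF kG nkG Gn; have lb := weight_lower_bound tF kG nkG.
split=> [wF|H]; last first.
  suff [F' [cF' wF']] : exists F' : {set {set G}}, covering F' /\ weight F' + k < n.
    by have := tight_le tF cF'; move: wF' lb; rewrite Gn; card_lia.
  case: H => [/perfectly_connected_weight|]; first by rewrite Gn.
  apply: (class_A_weight Gn); have [kn _] := kG.
  by rewrite -Gn kn andbT; apply: leq_trans k3.
case: (min_cut kG nkG) => [[v cN]|[A [B [dAB nAB A2 B2 cutk]]]]; last first.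
  right; apply: (two_sided_A tF k3 dAB nAB A2 B2 cutk Gn).
  by move: wF; rewrite -Gn (two_sided_card dAB cutk); card_lia.
left; apply: (apex_perfect tF cN) => S SF.
have [dAB nAB cB] := apex_cut cN; have /= ts := apex_total_span tF cN.
set B := ~: _ in dAB nAB cB ts *.
have /eqP : \sum_(S in F) excess [set v] B S = 0.
  move: wF ts; rewrite -Gn -cB (weight_excess tF dAB nAB).
  by move: (total_span _ _ _) (\sum_(_ in _) _) => t e; card_lia.
by rewrite sum_nat_eq0 => /forall_inP/(_ S SF)/eqP.
Qed.

Lemma weight_near_extremal (G : sgraph) (k n : nat) (F : {set {set G}}) :
  3 <= k -> tight F -> k_connected k G -> ~ k_connected k.+1 G -> #|G| = n ->
  (weight F + k = n <-> class_B1 G n k \/ class_B2 G n k \/ class_B3 G n k).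
Proof.
move=> k3 tF kG nkG Gn; have lb := weight_lower_bound tF kG nkG.
have ext := weight_extremal k3 tF kG nkG Gn.
have [kn _] := kG.
split=> [wF|H]; last first.
  have [[F' [cF' wF']] nPC nA] : [/\ exists F' : {set {set G}}, covering F' /\ weight F' + k <= n,
      ~ perfectly_connected G k & ~ class_A G n k].
    have out2 (U W : {set G}) : join_partition U W -> is_complete (k - 2) (induced U) ->
        connected (induced W) -> exists F' : {set {set G}}, covering F' /\ weight F' + k <= n.
      move=> jUW cU cW; have [F' [cF' wF']] := join_complete_weight jUW cU cW.
      by exists F'; split=> //; move: wF'; rewrite Gn; move: k3 kn; rewrite Gn; card_lia.
    case: H => [[_ _ [u [U [pU cU mU _]]] nPC nA]|[|]].
    - split=> //; have [|F' [cF' wF']] := parts_weight pU _ mU.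
        by move=> i; have /connected_induced[] := cU i.
      by exists F'; split=> //; move: wF' k3; rewrite Gn; card_lia.
    - case=> _ _ [U [W [jUW cU [W2 cW] _]]] nPC nA; split=> //.
      apply: out2 jUW cU _.
      (* 2-connectedness, applied to the empty set, gives connectedness of the graph on [W]. *)
      have /cW/connected_induced[ne li] : #|@set0 (induced W)| < 2 by rewrite cards0.
      apply/connected_induced; rewrite setC0 in ne li; split.
        by rewrite -card_gt0 -card_induced; apply: leq_trans W2.
      by rewrite -(imset_val_setT W) linked_val.
    - case=> _ _ [U [W [jUW cU cW _]]] nPC nA; split=> //.
      have [F' [cF' wF']] := join_complete_minus_weight jUW cU cW.
      by exists F'; split=> //; move: wF' k3 kn; rewrite Gn; card_lia.
  have nw : weight F + k.+1 != n by apply/eqP => /ext[].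
  by have := tight_le tF cF'; move: wF' lb nw; rewrite Gn; card_lia.
have [nPC nA] : ~ perfectly_connected G k /\ ~ class_A G n k.
  have nw : ~ (weight F + k.+1 = n) by rewrite addnS wF => /eqP; rewrite eqn_leq ltnn.
  by split=> h; apply: nw; apply/ext; [left|right].
case: (min_cut kG nkG) => [[v cN]|[A [B [dAB nAB A2 B2 cutk]]]]; last first.
  have wF2 : weight F = #|A| + #|B|.
    by move: wF; rewrite -Gn (two_sided_card dAB cutk); card_lia.
  by right; case: (two_sided_B tF k3 kG dAB nAB A2 B2 cutk wF2) => h; [left|right].
left; split=> //; apply: (apex_B1 tF cN); first exact: leq_trans k3.
have [dAB nAB cB] := apex_cut cN; have /= ts := apex_total_span tF cN.
set B := ~: _ in dAB nAB cB ts *.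
move: wF ts; rewrite -Gn -cB (weight_excess tF dAB nAB).
by move: (total_span _ _ _) (\sum_(_ in _) _) => t e; card_lia.
Qed.

(* The truncated subtraction m - n is exact: k-connectedness with k >= 3
   forces n <= m. *)
Theorem theorem2p3 (k n m : nat) (G : sgraph)
    (hk : 3 <= k) (hn : #|G| = n) (hm : #|edges G| = m)
    (hconn : k_connected k G) (hnconn : ~ k_connected k.+1 G) :
  mc G = m - n + k <->
  class_B1 G n k \/ class_B2 G n k \/ class_B3 G n k.
Proof.
have [|_ lG] := @k_connected_linked _ _ set0 hconn.
  by rewrite cards0; apply: leq_trans hk.
rewrite setC0 in lG; have [F tF] := exists_tight lG.
have nm : n <= m by rewrite -hn -hm; apply: card_le_edges hconn; apply: leq_trans hk.
have mcF := mc_tight tF; rewrite hm in mcF.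
have [kn _] := hconn; rewrite hn in kn.
rewrite -(weight_near_extremal hk tF hconn hnconn hn).
(* Since [mc G + weight F = m] and [n <= m], the equation for [mc G] amounts to
   [weight F + k = n]. *)
by split; move: mcF nm kn; move: (mc G) (weight F) => c w; clear; lia.
Qed.
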